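(* Let $I,J\subset\mathbb{R}$ be (nonempty) open, bounded intervals such that $\overline{I}\cap\overline{J}=\emptyset$. Let $H_J:L^2(\mathbb{R})\to L^2(\mathbb{R})$ denote the truncated Hilbert transform with respect to $J$, and assume that $g\in H^1(J)$, $g\neq 0$. Then there exist constants $\tilde\sigma>0$ and $C>1$, which depend only on the relative size and distance of the intervals $I$ and $J$ (and not on $g$), such that $$\|g\|_{H^1(J)}\le \exp\left(C\left(1+\frac{\|g\|_{H^1(J)}^{\tilde\sigma}}{\|g\|_{L^2(J)}^{\tilde\sigma}}\right)\right)\|H_Jg\|_{L^2(I)}.$$
   Context: The Hilbert transform on $L^2(\mathbb{R})$ is $Hf(x)=\mathrm{p.v.}\int_{\mathbb{R}}\frac{f(t)}{x-t}\,dt$. For an open bounded interval $J$ with characteristic function $\chi_J$, the truncated Hilbert transform with respect to $J$ is $H_Jg:=H(g\chi_J)\in L^2(\mathbb{R})$, where for $g\in L^2(J)$ the product $g\chi_J$ denotes the extension of $g$ by zero. The relative size and distance of $I$ and $J$ are the length of $I$ and the distance between $I$ and $J$ after the two intervals have been normalized, by translation and rescaling, so that $J=(0,1)$ and (without loss of generality) $I=(a,b)$ with $-\infty<a<b<0$; that is, the numbers $b-a$ and $|b|$.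
   Formalization: With the usual H^1 norm the estimate is not invariant under dilation and fails uniformly as |J| grows, so C may also depend on an upper bound L for |J|; for |J| ≤ 1, hence for J=(0,1), the constants depend only on the relative size and distance. *)

(* Defs.v *)
From HB Require Import structures.
From mathcomp Require Export all_boot all_order all_algebra.
From mathcomp Require Export all_classical all_reals all_analysis.
Set Implicit Arguments.
Unset Strict Implicit.
Unset Printing Implicit Defensive.
Export Order.TTheory GRing.Theory Num.Theory.
Export numFieldNormedType.Exports.

Local Open Scope classical_set_scope.
Local Open Scope ring_scope.

Section Defs.
Context {R : realType}.
Local Notation mu := (@lebesgue_measure R).
Implicit Types (f g h phi : R -> R) (J A B : set R).

(* Functions are real-valued, and only their values on J matter for membership
   in L^2(J) and for the L^2(J) norm: g \_ J is the extension by zero. *)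
Definition L2 J g : Prop := g \_ J \in Lfun mu 2%:E.

Definition L2norm J g : R := fine 'N[mu]_2%:E[EFin \o (g \_ J)]%E.

(* C_c^oo(J) *)
Definition test_function J phi : Prop :=
  (forall n x, derivable (phi^`(n)%classic : R -> R) x 1) /\
  exists K : set R, [/\ compact K, K `<=` J & forall x, ~ K x -> phi x = 0].

Definition is_weak_derivative J g h : Prop :=
  forall phi, test_function J phi ->
    \int[mu]_(x in J) (g x * phi^`()%classic x) = - \int[mu]_(x in J) (h x * phi x).

Definition H1 J g : Prop :=
  L2 J g /\ exists h, L2 J h /\ is_weak_derivative J g h.

(* The weak derivative is unique up to a.e. equality on J, so the H^1 norm does
   not depend on the representative chosen by xget. *)
Definition weak_derivative J g : R -> R :=
  xget (cst 0) [set h | L2 J h /\ is_weak_derivative J g h].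

Definition H1norm J g : R :=
  Num.sqrt (L2norm J g ^+ 2 + L2norm J (weak_derivative J g) ^+ 2).

(* p.v. \int f(t) / (x - t) dt; for f in L^2(R) the truncated integrals converge
   absolutely, and the limit exists for almost every x. *)
Definition hilbert f (x : R) : R :=
  lim ((\int[mu]_(t in [set t | (eps < `|x - t|)%R]) (f t / (x - t)))
         @[eps --> 0^'+]).

Definition truncated_hilbert J g : R -> R := hilbert (g \_ J).

Definition set_dist A B : R := inf [set `|x - y| | x in A & y in B].

(* The affine map x |-> (x - c) / (d - c), followed if necessary by the
   reflection x |-> 1 - x, sends ]c, d[ to ]0, 1[ and ]a, b[ to the left of 0;
   it divides lengths and distances by d - c. *)
Definition relative_size (a b c d : R) : R := (b - a) / (d - c).

Definition relative_distance (a b c d : R) : R :=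
  set_dist `]a, b[ `]c, d[ / (d - c).

End Defs.

(* Main.v *)
Require Import Defs.
From mathcomp Require Import ring lra measurable_realfun.

(** The estimate is a quantitative unique continuation statement, proved by
    duality.  For x in I the value Hg(x) is the integral over J of
    g(t) / (x - t), so every combination K of the kernels t |-> 1 / (t - x_i)
    with nodes x_i in I gives a pairing of g with K that is at most the sum of
    the moduli of the coefficients times the largest |Hg(x_i)|.  It suffices to
    find K, of controlled cost, whose pairing with g is large.

    Where to aim.  A function with weak derivative h satisfies
    |g(p) - g(q)| <= sqrt |p - q| ||h|| at its Lebesgue points
    ([weak_derivative_holder], by testing against smoothed indicators of
    intervals).  So around a point t0 where |g| is at least half its quadratic
    mean ([exists_large_value]) g keeps its sign on a neighbourhood whose size
    is a power of 1 / q, where q = ||g||_H1 / ||g||_L2, and elsewhere |g| is at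
    most a multiple of q |g(t0)|.  A positive K that is sharply peaked at t0
    therefore has a large pairing with g ([peak_integral_ge]).

    The peak.  Put w = 1 / (t - x) and w0 = 1 / (t0 - x) for one x in I.  With v
    a small multiple of w - w0, the function w (1 - v^2)^N = w (1 - v)^N (1 + v)^N
    is peaked at t0 and is a polynomial in w.  Replacing x by a different node
    in each of the 2N + 1 factors perturbs the peak little if the nodes lie
    close together ([peaked_kernel_bounds]), and then partial fractions turn
    the product into a combination of simple kernels; merging one more factor
    multiplies the cost by at most a constant plus a multiple of the inverse
    distance of the nodes ([cauchy_product_bound]).  No sharp control of this
    cost is needed: N and the inverse distances are polynomial in q, and any
    bound of the form (polynomial in q)^(polynomial in q) is absorbed in
    exp (C q^18) ([observability_cost]).

    From the norm to point values.  The nodes are chosen one in each of 2N + 1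
    disjoint cells of I, at places where |Hg| is at most its L^2 norm, or slightly
    more, divided by the square root of the length of the cell
    ([exists_nodes]). *)

Set Implicit Arguments.
Unset Strict Implicit.
Unset Printing Implicit Defensive.
Local Open Scope classical_set_scope.
Local Open Scope ring_scope.

(** * Smooth test functions *)

Section Bump.
Context {R : realType}.
Local Notation mu := (@lebesgue_measure R).

(** This family contains exp (- 1 / (1 - x^2)) and is closed under
    differentiation. *)
Definition bump_fam (P : {poly R}) (k : nat) (x : R) : R :=
  if `|x| < 1 then P.[x] / (1 - x ^+ 2) ^+ k * expR (- (1 - x ^+ 2)^-1) else 0.

(** A quadratic bound at x yields both f(x) = 0 and a vanishing derivative;
    this handles the points where the pieces of [bump_fam] are glued. *)
Lemma is_derive_flat (f : R -> R) (x C : R) :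
  (forall y, `|f y| <= C * (y - x) ^+ 2) -> is_derive x (1 : R) f 0.
Proof.
move=> fC.
have fx0 : f x = 0.
  by apply/eqP; rewrite -normr_le0 (le_trans (fC x))// subrr expr0n/= mulr0.
apply/is_derive1_caratheodory; exists (fun y => f y / (y - x)); split.
- move=> z; have [->|zx] := eqVneq z x; first by rewrite fx0 !subrr mulr0.
  by rewrite fx0 subr0 mulfVK// subr_eq0.
- have C1_gt0 : 0 < `|C| + 1 by rewrite ltr_wpDl.
  rewrite /prop_for /continuous_at [X in _ --> X](_ : _ = 0); last by rewrite subrr invr0 mulr0.
  apply/cvgrPdist_le => e e0; near=> y.
  rewrite sub0r normrN normrM normfV.
  have [->|yx] := eqVneq y x; first by rewrite fx0 normr0 mul0r ltW.
  rewrite ler_pdivrMr ?normr_gt0 ?subr_eq0//.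
  apply: (le_trans (fC y)).
  rewrite -real_normK ?num_real// expr2 mulrA ler_wpM2r//.
  have h : `|y - x| <= e / (`|C| + 1).
    rewrite distrC; near: y; apply: (@cvgr_dist_le _ R^o) => //.
    by rewrite divr_gt0.
  rewrite (le_trans (ler_wpM2r (normr_ge0 _) (ler_norm C)))//.
  rewrite (le_trans (ler_wpM2l (normr_ge0 _) h))//.
  by rewrite mulrCA ger_pMr// ler_pdivrMr// mul1r lerDl.
- by rewrite subrr invr0 mulr0.
Unshelve. all: by end_near. Qed.

(** One term of the exponential series at 1 / y, of order k + 2, beats y^-k with
    a factor y^2 to spare. *)
Lemma exp_neg_inv_bound (k : nat) (y : R) : 0 < y ->
  y ^- k * expR (- y^-1) <= (k.+2)`!%:R * y ^+ 2.
Proof.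
move=> y0; rewrite expRN.
have := @expR_ge1Dxn R y^-1 k.+1 (ltW (etrans (invr_gt0 _) y0)).
move=> h.
have fp : (0 : R) < (k.+2)`!%:R by rewrite ltr0n fact_gt0.
rewrite ler_pdivrMr ?expR_gt0//.
have : y ^- k.+2 / (k.+2)`!%:R <= expR y^-1.
  by rewrite -exprVn (le_trans _ h)// lerDr.
rewrite ler_pdivrMr// => h2.
have -> : y ^- k = y ^+ 2 * y ^- k.+2.
  rewrite -(addn2 k) exprD invfM mulrCA mulfV ?mulr1//.
  by rewrite expf_neq0// gt_eqF.
by rewrite [leRHS]mulrAC [leRHS]mulrC ler_pM2l ?exprn_gt0// mulrC.
Qed.

(** The exponential beats every power of 1 - y^2, and 1 - y^2 is at most twice
    the distance from y to any point outside ]-1, 1[. *)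
Lemma bump_fam_flat (P : {poly R}) (k : nat) : exists C : R,
  forall x y, 1 <= `|x| -> `|bump_fam P k y| <= C * (y - x) ^+ 2.
Proof.
have [C hC] : exists C : R, forall x : R, `|x| <= 1 -> `|P.[x]| <= C.
  by have [C hC] := poly_disk_bound P 1; exists C.
pose K : R := `|C| * ((k.+2)`!%:R * 4).
have K0 : 0 <= K by rewrite !mulr_ge0.
exists K => x y x1; rewrite /bump_fam.
case: ifPn => y1; last by rewrite normr0 mulr_ge0// sqr_ge0.
have u0 : 0 < 1 - y ^+ 2.
  by rewrite subr_gt0 -real_normK ?num_real// expr_lt1.
rewrite -mulrA normrM [X in _ * X]ger0_norm; last first.
  by rewrite mulr_ge0 ?expR_ge0// invr_ge0 exprn_ge0// ltW.
rewrite -mulrA ler_pM//.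
- by rewrite mulr_ge0 ?expR_ge0// invr_ge0 exprn_ge0// ltW.
- by rewrite (le_trans (hC y (ltW y1)))// ler_norm.
apply: (le_trans (exp_neg_inv_bound k u0)).
rewrite -mulrA ler_wpM2l//.
have -> : 4 * (y - x) ^+ 2 = (2 * `|y - x|) ^+ 2.
  by rewrite exprMn real_normK ?num_real//; ring.
have h : 1 - `|y| <= `|y - x|.
  by apply: (le_trans (lerB x1 (lexx _))); rewrite distrC lerB_dist.
have h' : 1 - y ^+ 2 <= 2 * `|y - x|.
  rewrite -real_normK ?num_real//; have := normr_ge0 y; nra.
by rewrite ler_sqr ?nnegrE// ltW// (lt_le_trans u0).
Qed.

(** Writing u = 1 - x^2, one has (P u^-k e^(-1/u))' =
    (P' u^2 + 2 k x P u - 2 x P) u^(-k-2) e^(-1/u). *)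
Lemma is_derive_bump_fam (P : {poly R}) (k : nat) (x : R) :
  is_derive x (1 : R) (bump_fam P k)
    (bump_fam (P^`() * (1 - 'X^2) ^+ 2 + k%:R *: (2 *: 'X * P * (1 - 'X^2))
               - 2 *: 'X * P) k.+2 x).
Proof.
have [x1|x1] := ltP `|x| 1; last first.
  rewrite /bump_fam ltNge x1/=.
  have [C hC] := bump_fam_flat P k.
  by apply: is_derive_flat => y; exact: hC.
have u0 : 0 < 1 - x ^+ 2.
  by rewrite subr_gt0 -real_normK ?num_real// expr_lt1.
have du : is_derive x (1 : R) (fun y : R => (1 - y ^+ 2)^-1)
    (- (1 - x ^+ 2) ^- 2 *: (0 - (2%:R * x ^+ 1) *: 1)).
  apply: is_deriveV; first by rewrite gt_eqF.
  apply: is_deriveB.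
  exact: (@is_deriveX _ _ (@id R) 2 x 1 1).
have dv : is_derive x (1:R) (fun y : R => expR (- (1 - y ^+ 2)^-1))
   (expR (- (1 - x ^+ 2)^-1) * - (- (1 - x ^+ 2) ^- 2 *: (0 - (2%:R * x ^+ 1) *: 1))).
  exact: (@is_derive1_comp _ expR (fun y : R => - (1 - y ^+ 2)^-1)).
have dw : is_derive x (1:R) (fun y : R => (1 - y ^+ 2)^-1 ^+ k)
    ((k%:R * (1 - x ^+ 2)^-1 ^+ k.-1) *: (- (1 - x ^+ 2) ^- 2 *: (0 - (2%:R * x ^+ 1) *: 1))).
  by have := @is_deriveX _ _ (fun y : R => (1 - y ^+ 2)^-1) k x 1 _ du; rewrite exprfctE.
have := is_deriveM (is_deriveM (is_derive_poly P x) dw) dv.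
set df := (X in is_derive _ _ _ X) => H.
set df' := (X in is_derive _ _ _ X).
have E : df = df'.
  rewrite /df /df' /bump_fam x1 !hornerE mulrfctE /=.
  pose u : R := 1 - x ^+ 2; rewrite -/u in u0 *.
  have u0' : u != 0 by rewrite gt_eqF.
  rewrite /GRing.scale /=.
  case: k {dw H df df'} => [|k]/=.
    by rewrite !expr0; field.
  rewrite !exprVn !exprS. field.
  by rewrite u0' expf_neq0.
rewrite -E; apply: near_eq_is_derive H.
near=> y; rewrite /bump_fam ifT.
  by rewrite mulrfctE /=  mulrfctE exprVn.
near: y; exists (1 - `|x|) => /=; first by rewrite subr_gt0.
move=> y /= xy.
by rewrite (_ : y = x - (x - y)) ?(le_lt_trans (ler_normB _ _)) -?ltrBrDl//; ring.
Unshelve. all: by end_near. 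
Qed.

Definition bump : R -> R := bump_fam 1 0.

Lemma bump_ge0 x : 0 <= bump x.
Proof.
rewrite /bump /bump_fam; case: ifP => // _.
by rewrite hornerE expr0 divr1 mul1r expR_ge0.
Qed.

Lemma bump_le1 x : bump x <= 1.
Proof.
rewrite /bump /bump_fam; case: ifP => // x1.
rewrite hornerE expr0 divr1 mul1r -expR0 ler_expR oppr_le0 invr_ge0.
by rewrite subr_ge0 -real_normK ?num_real// expR0 expr_le1// ltW.
Qed.

Lemma bump_gt0 x : `|x| < 1 -> 0 < bump x.
Proof.
by move=> x1; rewrite /bump /bump_fam x1 hornerE expr0 divr1 mul1r expR_gt0.
Qed.

Lemma bump_out x : 1 <= `|x| -> bump x = 0.
Proof. by move=> x1; rewrite /bump /bump_fam ltNge x1. Qed.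

Lemma derivable_continuous1 (f : R -> R) :
  (forall x, derivable f x (1 : R)) -> continuous f.
Proof. by move=> df x; apply: differentiable_continuous; apply/derivable1_diffP. Qed.

Lemma continuous_bump : continuous bump.
Proof.
apply: derivable_continuous1 => x.
by have := is_derive_bump_fam 1 0 x => -[].
Qed.

(** D 0 is a primitive of [bump] and D n its n-th derivative.  The sequence
    format makes the iterated derivatives of affine reparametrizations
    immediate. *)
Lemma smooth_step : exists (D : nat -> R -> R) (c : R),
  [/\ 0 < c, forall n (x : R), is_derive x (1 : R) (D n) (D n.+1 x),
    D 1%N = bump /\ {homo D 0%N : x y / x <= y}, forall x : R, x <= -1 -> D 0%N x = 0 &
    forall x, 1 <= x -> D 0%N x = c].
Proof.
(* Any base point below -1 gives the same primitive. *)
pose Th (x : R) : R := (\int[mu]_(t in [set` `[-2, x]]) bump t)%R.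
have iB (u : R) : mu.-integrable `[-2, u] (EFin \o bump).
  apply: continuous_compact_integrable; first exact: segment_compact.
  by apply: continuous_subspaceT; exact: continuous_bump.
have Th0 (x : R) : x < -1 -> Th x = 0.
  move=> x1; rewrite /Th (@eq_Rintegral _ _ _ _ _ (cst 0)) ?Rintegral_cst ?mul0r//.
  move=> t; rewrite inE /= in_itv/= => /andP[_ tx].
  by rewrite bump_out// ler_normr (_ : 1 <= - t) ?orbT//; lra.
have dTh (x : R) : is_derive x (1 : R) Th (bump x).
  have [x1|x1] := ltP x (-1).
    rewrite bump_out; last by rewrite ler_normr (_ : 1 <= - x) ?orbT//; lra.
    apply: (@near_eq_is_derive _ _ _ (cst 0)).
    near=> y; rewrite Th0//; near: y.
    exact: lt_nbhsl.
  have [] := @continuous_FTC1_closed R bump (-2) x (x + 1) _ (iB _) _ _.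
  - by rewrite ltrDl.
  - lra.
  - exact: continuous_bump.
  by move=> dx <-; rewrite derive1E; apply: derivableP.
have cTh : continuous Th by apply: derivable_continuous1 => x; have [] := dTh x.
have mvt (a b : R) : a < b -> exists2 xi, xi \in `]a, b[ & Th b - Th a = bump xi * (b - a).
  by move=> ab; apply: MVT => //; apply: continuous_subspaceT.
have Thm1 : Th (-1) = 0.
  have [|xi] := mvt (-2) (-1); first lra.
  rewrite in_itv/= => /andP[_ h]; rewrite bump_out ?mul0r.
    by rewrite (Th0 (-2)) ?subr0//; lra.
  by rewrite ler_normr (_ : 1 <= - xi) ?orbT//; lra.
have Th1 (x : R) : 1 <= x -> Th x = Th 1.
  rewrite le_eqVlt => /predU1P[<-//|x1].
  have [|xi] := mvt 1 x; first lra.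
  rewrite in_itv/= => /andP[h _]; rewrite bump_out ?mul0r.
    by move/eqP; rewrite subr_eq0 => /eqP.
  by rewrite ler_normr (ltW h).
pose PK := fix PK n : {poly R} * nat := if n is m.+1 then
  let: (P, k) := PK m in
  (P^`() * (1 - 'X^2) ^+ 2 + k%:R *: (2 *: 'X * P * (1 - 'X^2)) - 2 *: 'X * P, k.+2)
  else (1, 0%N).
exists (fun n => if n is m.+1 then bump_fam (PK m).1 (PK m).2 else Th), (Th 1).
split => //.
- have [|xi] := mvt (-1) 1; first lra.
  rewrite Thm1 subr0 => /itvP xx ->.
  by rewrite mulr_gt0 ?bump_gt0 ?ltr_norml ?xx//; lra.
- move=> [|n] x; first exact: dTh.
  by have := is_derive_bump_fam (PK n).1 (PK n).2 x; rewrite /=; case: (PK n).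
- split=> // x y; rewrite le_eqVlt => /predU1P[->//|xy]; have [xi _ E] := mvt _ _ xy.
  by rewrite -subr_ge0 E mulr_ge0 ?bump_ge0// subr_ge0 ltW.
- move=> x; rewrite le_eqVlt => /predU1P[->//|]; exact: Th0.
Unshelve. all: by end_near.
Qed.

Lemma is_derive_rescale (f : R -> R) (df p e x : R) :
  is_derive ((x - p) / e) (1 : R) f df ->
  is_derive x (1 : R) (fun y => f ((y - p) / e)) (e^-1 * df).
Proof.
move=> fd.
have da : is_derive x (1 : R) (fun y : R => (y - p) / e) e^-1.
  have := @is_deriveZ _ _ _ (fun y : R => y - p) e^-1 x 1 1 _.
  rewrite (_ : e^-1 \*: (fun y : R => y - p) = fun y : R => (y - p) / e); last first.
    by apply/funext => y; rewrite /= /GRing.scale/= mulrC.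
  rewrite /GRing.scale/= mulr1; apply.
  have := @is_deriveB _ _ _ id (cst p) x 1 1 0 _ _.
  by rewrite subr0; apply.
rewrite mulrC; exact: (@is_derive1_comp _ f (fun y : R => (y - p) / e)).
Qed.

(** Differences of two rescaled smooth steps are smoothed indicators of [p, q].
    The constant c0 is the total mass of the bump, which is left unnormalized. *)
Lemma plateau_test_functions : exists2 c0 : R, 0 < c0 &
  forall a b e : R, 0 < e ->
  (forall p, a <= p - e -> p + e <= b ->
    \int[mu]_(x in `]a, b[) (e^-1 * bump ((x - p) / e)) = c0) /\
  forall p q : R, p <= q -> a < p - e -> q + e < b ->
  exists phi : R -> R, [/\ test_function `]a, b[ phi,
    forall x, phi^`()%classic x = e^-1 * bump ((x - p) / e) - e^-1 * bump ((x - q) / e),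
    forall x, 0 <= phi x <= c0 &
    forall x : R, x \notin `[p - e, q + e] -> phi x = 0].
Proof.
have [D [c0 [c0_gt0 dD [D1 D_ndecr] D0 Dc]]] := smooth_step.
exists c0 => // a b e e0; split.
  move=> p ap pb.
  pose F x := D 0%N ((x - p) / e).
  have dF (x : R) : is_derive x (1:R) F (e^-1 * bump ((x - p) / e)).
    by rewrite -D1; exact: is_derive_rescale.
  have cF : continuous F by apply: derivable_continuous1 => x; have [] := dF x.
  have ab : a < b by lra.
  have cf : continuous (fun x : R => e^-1 * bump ((x - p) / e)).
    move=> x; apply: cvgM; first exact: cvg_cst.
    apply: (@continuous_comp _ _ _ (fun x : R => (x - p) / e) bump); last exact: continuous_bump.
    by apply: cvgM; [apply: cvgB; [exact: cvg_id|exact: cvg_cst]|exact: cvg_cst].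
  have icf : mu.-integrable `[a, b] (EFin \o (fun x : R => e^-1 * bump ((x - p) / e))).
    apply: continuous_compact_integrable; first exact: segment_compact.
    exact: continuous_subspaceT.
  have h := @continuous_FTC2 R (fun x : R => e^-1 * bump ((x - p) / e)) F a b ab.
  rewrite Rintegral_itv_obnd_cbnd; last first.
    by apply: integrableS icf => //; exact: subset_itv_oo_cc.
  rewrite Rintegral_itv_bndo_bndc; last first.
    by apply: integrableS icf => //; exact: subset_itv_co_cc.
  rewrite /Rintegral h/=.
  - rewrite /F (D0 ((a - p) / e)) ?(Dc ((b - p) / e)) ?subr0//.
      by rewrite ler_pdivlMr// mul1r; lra.
    by rewrite ler_pdivrMr// mulN1r; lra.
  - exact: continuous_subspaceT.
  - split; [by move=> x _; have [] := dF x| |].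
      by apply: cvg_at_right_filter; exact: cF.
    by apply: cvg_at_left_filter; exact: cF.
  - by move=> x _; rewrite derive1E; have [] := dF x.
move=> p q pq ap qb.
pose phi n x := e^-1 ^+ n * (D n ((x - p) / e) - D n ((x - q) / e)).
have dphi n (x : R) : is_derive x (1 : R) (phi n) (phi n.+1 x).
  have h1 := is_derive_rescale (dD n ((x - p) / e)).
  have h2 := is_derive_rescale (dD n ((x - q) / e)).
  have := is_deriveZ (e^-1 ^+ n) (is_deriveB h1 h2).
  rewrite /GRing.scale/= -mulrBr mulrA -exprSr; exact.
have phiE n : (phi 0%N)^`(n)%classic = phi n.
  elim: n => [//|n IH]; rewrite derive1nS IH; apply/funext => x.
  by rewrite derive1E; have [] := dphi n x.
have De x p' : p' + e <= x -> D 0%N ((x - p') / e) = c0.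
  by move=> xp; rewrite Dc// ler_pdivlMr// mul1r; lra.
have D0e x p' : x <= p' - e -> D 0%N ((x - p') / e) = 0.
  by move=> xp; rewrite D0// ler_pdivrMr// mulN1r; lra.
have D_ge0 x : 0 <= D 0%N x.
  have [x1|x1] := leP x (-1); first by rewrite D0.
  by rewrite -(D0 (-1))// D_ndecr// ltW.
have D_le x : D 0%N x <= c0.
  have [x1|x1] := leP 1 x; first by rewrite Dc.
  by rewrite -(Dc 1)// D_ndecr// ltW.
have phi_out x : x \notin `[p - e, q + e] -> phi 0%N x = 0.
  rewrite in_itv/= negb_and -!ltNge /phi expr0 mul1r => /orP[h|h].
    by rewrite !D0e ?subrr//; lra.
  by rewrite !De ?subrr//; lra.
exists (phi 0%N); split => //.
- split; first by move=> n x; rewrite phiE; have [] := dphi n x.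
  exists [set` `[p - e, q + e]]; split.
  + exact: segment_compact.
  + move=> x /=; rewrite !in_itv/= => /andP[px xq]; apply/andP; split; lra.
  + by move=> x /negP; exact: phi_out.
- by move=> x; rewrite derive1E; have [_ ->] := dphi 0%N x; rewrite /phi D1 expr1 mulrBr.
- move=> x; rewrite /phi expr0 mul1r subr_ge0 D_ndecr//=.
    by rewrite lerBlDr (le_trans (D_le _))// lerDl.
  by rewrite ler_pM2r ?invr_gt0//; lra.
Qed.

End Bump.

(** * Square-integrable functions on an interval *)

Section L2.
Context {R : realType}.
Local Notation mu := (@lebesgue_measure R).
Implicit Types (J A : set R) (f g : R -> R).

Lemma lebesgue_measure_oo_lty (a b : R) : (mu `]a, b[ < +oo)%E.
Proof. by rewrite /= lebesgue_measure_itv/= lte_fin; case: ifP => //; rewrite -EFinB ltry. Qed.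

Lemma L2_measurable J g : L2 J g -> measurable_fun setT (g \_ J).
Proof. by rewrite /L2 inE => /andP[/[!inE]]. Qed.

Lemma L2norm_ge0 J g : 0 <= L2norm J g.
Proof. by rewrite fine_ge0// Lnorm_ge0. Qed.

Lemma L2norm_EFin J g : L2 J g ->
  (L2norm J g)%:E = 'N[mu]_2%:E[EFin \o (g \_ J)]%E.
Proof.
rewrite /L2 inE => /andP[_ /[!inE]/= gfin].
by rewrite /L2norm fineK// ge0_fin_numE// Lnorm_ge0.
Qed.

Lemma L2norm_sqr J g : L2 J g ->
  ((L2norm J g ^+ 2)%:E = \int[mu]_(x in J) (g x ^+ 2)%:E)%E.
Proof.
move=> gL2; rewrite -(powR_mulrn 2 (L2norm_ge0 J g)) -poweR_EFin (L2norm_EFin gL2).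
rewrite poweR_Lnorm// [RHS]integral_mkcond.
apply: eq_integral => x _ /=.
rewrite /patch; case: ifP => _ /=.
  by rewrite powR_mulrn// real_normK ?num_real.
by rewrite normr0 powR0.
Qed.

(** The Cauchy-Schwarz inequality against the indicator of A. *)
Lemma integral_norm_le_L2 J A g : measurable J -> measurable A -> A `<=` J ->
  (mu A < +oo)%E -> L2 J g ->
  (\int[mu]_(x in A) `|(g x)%:E| <= (Num.sqrt (fine (mu A)) * L2norm J g)%:E)%E.
Proof.
move=> mJ mA AJ muA gL2.
have mg := L2_measurable gL2.
have h2 : 2^-1 + 2^-1 = 1 :> R by lra.
have := @hoelder _ _ _ mu (g \_ J) (\1_A) 2 2 mg (measurable_indic mA) (ltr0Sn _ _) (ltr0Sn _ _) h2.
rewrite Lnorm1 -(L2norm_EFin gL2) muleC.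
have -> : ('N[mu]_2%:E[EFin \o \1_A] = (Num.sqrt (fine (mu A)))%:E)%E.
  rewrite unlock -powR12_sqrt ?fine_ge0// -poweR_EFin fineK ?ge0_fin_numE//.
  congr (_ `^ _)%E.
  rewrite -[in RHS](setIT A) -integral_indic//.
  apply: eq_integral => x _ /=; rewrite indicE.
  by case: (x \in A); rewrite /= ?normr1 ?normr0 ?powR1 ?powR0.
rewrite -EFinM => /(le_trans _); apply.
rewrite le_eqVlt; apply/orP; left; apply/eqP; rewrite [LHS]integral_mkcond.
apply: eq_integral => x _; rewrite /patch /= indicE.
case: ifPn => xA; last by rewrite mulr0 ?abse0 ?normr0.
by rewrite mem_set ?mulr1//; apply: AJ; rewrite inE in xA.
Qed.

Lemma L2_integrable J A g : measurable J -> measurable A -> A `<=` J ->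
  (mu A < +oo)%E -> L2 J g -> mu.-integrable A (EFin \o g).
Proof.
move=> mJ mA AJ muA gL2; apply/integrableP; split.
  apply/measurable_EFinP; apply: (measurable_funS mJ AJ).
  by apply/(measurable_restrictT _ mJ); exact: L2_measurable.
apply: le_lt_trans (ltry _); exact: (@integral_norm_le_L2 J).
Qed.

Lemma Rintegral_norm_le_L2 J A g : measurable J -> measurable A -> A `<=` J ->
  (mu A < +oo)%E -> L2 J g ->
  \int[mu]_(x in A) `|g x| <= Num.sqrt (fine (mu A)) * L2norm J g.
Proof.
move=> mJ mA AJ muA gL2; rewrite -lee_fin /Rintegral fineK.
  exact: integral_norm_le_L2.
rewrite ge0_fin_numE ?integral_ge0//.
by have /integrableP[] := L2_integrable mJ mA AJ muA gL2.
Qed.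

Lemma L2norm_eq0_ae J g : measurable J -> L2 J g -> L2norm J g = 0 ->
  {ae mu, forall x, J x -> g x = 0}.
Proof.
move=> mJ gL2 g0.
have mg := L2_measurable gL2.
have : (EFin \o (g \_ J)) = \0%R %[ae mu].
  apply: (@Lnorm_eq0_eq0 _ _ _ _ _ 2%:E) => //; first exact/measurable_EFinP.
  by rewrite -L2norm_EFin// g0.
apply: filterS; first exact: (ae_filter_ringOfSetsType mu).
move=> x /= /(_ I) [] + Jx.
by rewrite patchE mem_set.
Qed.

Lemma bounded_L2 J g (M : R) : measurable J -> (mu J < +oo)%E ->
  measurable_fun J g -> (forall x, J x -> `|g x| <= M) -> L2 J g.
Proof.
move=> mJ muJ mg gM.
have mgJ : measurable_fun setT (g \_ J) by apply/(measurable_restrictT _ mJ).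
rewrite /L2 inE; apply/andP; split; rewrite inE//=.
rewrite /finite_norm unlock poweR_lty//.
apply: (@le_lt_trans _ _ (\int[mu]_(x in J) (M `^ 2)%:E)%E); last first.
  by rewrite integral_cst//= lte_mul_pinfty// lee_fin powR_ge0.
rewrite [leRHS]integral_mkcond; apply: ge0_le_integral => //.
- by move=> x _; exact: poweR_ge0.
- apply: (measurableT_comp (measurable_poweR 2)).
  by apply: measurableT_comp => //; exact/measurable_EFinP.
- by apply/(measurable_restrictT _ mJ).
- move=> x _ /=; rewrite /patch; case: ifPn => xJ.
    rewrite lee_fin ge0_ler_powR ?nnegrE//.
      by rewrite (le_trans (normr_ge0 _) (gM x _))//; rewrite inE in xJ.
    by apply: gM; rewrite inE in xJ.
  by rewrite normr0 powR0.
Qed.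

Lemma L2norm_ge_on J A g (k : R) : measurable J -> measurable A -> A `<=` J -> 0 <= k ->
  L2 J g -> (forall x, A x -> k <= `|g x|) ->
  ((k ^+ 2)%:E * mu A <= (L2norm J g ^+ 2)%:E)%E.
Proof.
move=> mJ mA AJ k0 gL2 kg; rewrite L2norm_sqr// -integral_cst//.
have mg : measurable_fun J g.
  by apply/(measurable_restrictT _ mJ); exact: L2_measurable.
apply: (@le_trans _ _ (\int[mu]_(x in A) (g x ^+ 2)%:E)%E).
  apply: ge0_le_integral => //.
  - by move=> x _; rewrite lee_fin sqr_ge0.
  - apply/measurable_EFinP/measurable_funX; exact: measurable_funS mg.
  - move=> x Ax; rewrite lee_fin -[leRHS]real_normK ?num_real//.
    by rewrite ler_sqr ?nnegrE// kg.
apply: ge0_subset_integral => //.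
- exact/measurable_EFinP/measurable_funX.
- by move=> x _; rewrite lee_fin sqr_ge0.
Qed.

End L2.

(** * Bounded multipliers *)

Section BoundedMultiplier.
Context {R : realType}.
Local Notation mu := (@lebesgue_measure R).
Implicit Types (J : set R) (g k : R -> R).

Definition bounded_mfun J k :=
  measurable_fun J k /\ exists M : R, forall t, J t -> `|k t| <= M.

Lemma bounded_mfun_cst J (r : R) : bounded_mfun J (cst r).
Proof. by split; [exact: measurable_cst|exists `|r|]. Qed.

Lemma bounded_mfunM J k1 k2 : bounded_mfun J k1 -> bounded_mfun J k2 ->
  bounded_mfun J (fun t => k1 t * k2 t).
Proof.
move=> [m1 [M1 b1]] [m2 [M2 b2]]; split; first exact: measurable_funM.
by exists (M1 * M2) => t Jt; rewrite normrM ler_pM// ?b1 ?b2.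
Qed.

Lemma bounded_mfunD J k1 k2 : bounded_mfun J k1 -> bounded_mfun J k2 ->
  bounded_mfun J (fun t => k1 t + k2 t).
Proof.
move=> [m1 [M1 b1]] [m2 [M2 b2]]; split; first exact: measurable_funD.
exists (M1 + M2) => t Jt.
by rewrite (le_trans (ler_normD _ _))// lerD// ?b1 ?b2.
Qed.

Lemma bounded_mfun_cauchy J (x del : R) : measurable J -> 0 < del ->
  (forall t, J t -> del <= `|t - x|) -> bounded_mfun J (fun t => (t - x)^-1).
Proof.
move=> mJ del0 Jdel; split; last first.
  exists del^-1 => t Jt; rewrite normfV lef_pV2 ?posrE ?Jdel//.
  by rewrite (lt_le_trans del0)// Jdel.
apply: (@measurable_funS _ _ _ _ (~` [set x])).
- by apply: measurableC; exact: measurable_set1.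
- by move=> t /Jdel + tx; rewrite tx subrr normr0 leNgt del0.
apply: open_continuous_measurable_fun.
  by rewrite openC; apply: accessible_closed_set1; apply: hausdorff_accessible; exact: Rhausdorff.
move=> t; rewrite inE/= => /eqP tx.
apply: cvgV; first by rewrite subr_eq0.
by apply: cvgB; [exact: cvg_id|exact: cvg_cst].
Qed.

Lemma integrable_bounded_mfun J g k : measurable J -> bounded_mfun J k ->
  mu.-integrable J (EFin \o g) -> mu.-integrable J (EFin \o (fun t => g t * k t)).
Proof.
move=> mJ [mk [M kM]] gi.
have -> : EFin \o (fun t => g t * k t) = ((EFin \o g) \* (EFin \o k))%E.
  by apply/funext => t; rewrite /= EFinM.
apply: integrableMl => //; exists M; split; first exact: num_real.
by move=> y My t Jt; apply: (le_trans (kM t Jt)); exact: ltW.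
Qed.

Lemma bounded_mfun_integrable J k : measurable J -> (mu J < +oo)%E ->
  bounded_mfun J k -> mu.-integrable J (EFin \o k).
Proof.
move=> mJ muJ [mk [M kM]]; apply: measurable_bounded_integrable => //.
exists M; split; first exact: num_real.
by move=> y My x Jx; apply: (le_trans (kM x Jx)); exact: ltW.
Qed.

Lemma bounded_mfun_rescaled_bump J (p e : R) : measurable J -> 0 < e ->
  bounded_mfun J (fun x => e^-1 * bump ((x - p) / e)).
Proof.
move=> mJ e0; split.
  apply: measurable_funTS; apply: continuous_measurable_fun => x.
  apply: cvgM; first exact: cvg_cst.
  apply: (@continuous_comp _ _ _ (fun x : R => (x - p) / e) bump); last exact: continuous_bump.
  by apply: cvgM; [apply: cvgB; [exact: cvg_id|exact: cvg_cst]|exact: cvg_cst].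
exists e^-1 => x _; rewrite ger0_norm ?mulr_ge0 ?bump_ge0 ?invr_ge0 ?(ltW e0)//.
by rewrite ger_pMr ?invr_gt0// bump_le1.
Qed.

End BoundedMultiplier.

(** * Functions with a square-integrable weak derivative *)

Section Sobolev.
Context {R : realType}.
Local Notation mu := (@lebesgue_measure R).
Implicit Types (A : set R) (f g h k : R -> R).

(** The rescaled bump is at most 1 / e and lives on the ball of radius e, of
    measure 2 e, so that the error is at most twice the mean of |g - g p| over
    that ball. *)
Lemma mollify_near (a b p e c0 : R) g : 0 < e -> a < p - e -> p + e < b ->
  mu.-integrable `]a, b[ (EFin \o g) ->
  \int[mu]_(x in `]a, b[) (e^-1 * bump ((x - p) / e)) = c0 ->
  (`|\int[mu]_(x in `]a, b[) (g x * (e^-1 * bump ((x - p) / e))) - c0 * g p|%:E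
    <= 2%:E * davg (g \_ `]a, b[) p e)%E.
Proof.
move=> e0 ap pb gi kc.
set k := fun x => e^-1 * bump ((x - p) / e) in kc *.
have k_ge0 x : 0 <= k x by rewrite mulr_ge0 ?bump_ge0 ?invr_ge0 ?ltW.
have k_le x : k x <= e^-1 by rewrite ger_pMr ?invr_gt0// bump_le1.
have mJ : measurable [set` `]a, b[] by exact: measurable_itv.
have bk : bounded_mfun `]a, b[ k by exact: bounded_mfun_rescaled_bump.
have ki := bounded_mfun_integrable mJ (lebesgue_measure_oo_lty a b) bk.
have gki := integrable_bounded_mfun mJ bk gi.
have -> : \int[mu]_(x in `]a, b[) (g x * k x) - c0 * g p =
    \int[mu]_(x in `]a, b[) ((g x - g p) * k x).
  rewrite -kc mulrC -RintegralZl// -RintegralB//.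
    by apply: eq_Rintegral => x _; rewrite -mulrBl.
  exact: (integrableZl _ _ ki).
have gpi : mu.-integrable `]a, b[ (EFin \o (fun x => (g x - g p) * k x)).
  have -> : EFin \o (fun x => (g x - g p) * k x) =
      ((EFin \o (fun x => (g x * k x)%R)) \- (EFin \o (fun x => (g p * k x)%R)))%E.
    by apply/funext => x; rewrite /= -EFinB mulrBl.
  by apply: integrableB => //; exact: (integrableZl _ _ ki).
rewrite EFin_normr_Rintegral//.
apply: (le_trans (le_abse_integral _ _ _)) => //; first exact: (measurable_int mu).
rewrite /davg /iavg lebesgue_measure_ball; last exact: ltW.
have e20 : e *+ 2 != 0 by rewrite mulrn_eq0/= gt_eqF.
rewrite inver (negPf e20) muleA -EFinM (_ : 2 * (e *+ 2)^-1 = e^-1); last first.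
  by rewrite -(mulr_natr e); field; rewrite gt_eqF.
have mgJ : measurable_fun setT (g \_ `]a, b[).
  apply/(measurable_restrictT _ mJ); apply/measurable_EFinP.
  exact: (measurable_int mu).
rewrite -ge0_integralZl//; last 3 first.
- exact: measurable_ball.
- apply: measurable_funTS; apply: measurableT_comp => //; apply/measurable_EFinP.
  exact: measurable_funB.
- by rewrite lee_fin invr_ge0 ltW.
rewrite integral_mkcond [leRHS]integral_mkcond.
apply: ge0_le_integral => //.
- by move=> x _; rewrite /patch; case: ifP.
- apply/(measurable_restrictT _ mJ); apply: measurableT_comp => //.
  exact: (measurable_int mu).
- apply/(measurable_restrictT _ (measurable_ball _ _)).
  apply: measurable_funTS; apply: emeasurable_funM => //.
  apply: measurableT_comp => //; apply/measurable_EFinP.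
  exact: measurable_funB.
have pJ : p \in `]a, b[%classic by rewrite inE/= in_itv/=; apply/andP; split; lra.
move=> x _; rewrite /patch; case: ifPn => xJ; last first.
  by case: ifPn => //= _; rewrite mule_ge0// lee_fin invr_ge0 ltW.
case: ifPn => [xB|xB].
  by rewrite /= xJ pJ lee_fin normrM mulrC ler_wpM2r// ger0_norm.
have -> : k x = 0.
  rewrite /k bump_out ?mulr0// normrM normfV (gtr0_norm e0) ler_pdivlMr// mul1r.
  by rewrite leNgt distrC; apply/negP => h; case/negP: xB; rewrite inE.
by rewrite /= mulr0 normr0.
Qed.

(** Test the weak derivative against the smoothed indicator of [p, q] at scale
    e.  The derivative of the indicator recovers g p - g q at Lebesgue points as
    e tends to 0, while Cauchy-Schwarz on [p - e, q + e] bounds the other side. *)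
Lemma weak_derivative_holder (a b p q : R) g h :
  L2 `]a, b[ g -> L2 `]a, b[ h -> is_weak_derivative `]a, b[ g h ->
  p \in `]a, b[ -> q \in `]a, b[ ->
  lebesgue_pt (g \_ `]a, b[) p -> lebesgue_pt (g \_ `]a, b[) q ->
  `|g p - g q| <= Num.sqrt `|p - q| * L2norm `]a, b[ h.
Proof.
wlog pq : p q / p <= q.
  move=> H gL2 hL2 gh pJ qJ lp lq; have [pq|/ltW qp] := leP p q; first exact: H.
  by rewrite distrC [in leRHS]distrC; exact: H.
move=> gL2 hL2 gh; rewrite !in_itv/= => /andP[ap pb] /andP[aq qb] lp lq.
have [c0 c0_gt0 HT] := @plateau_test_functions R.
have mJ : measurable [set` `]a, b[] by exact: measurable_itv.
have muJ := lebesgue_measure_oo_lty a b.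
have gi := L2_integrable mJ mJ (@subset_refl _ _) muJ gL2.
pose dp e := fine (davg (g \_ `]a, b[) p e).
pose dq e := fine (davg (g \_ `]a, b[) q e).
have dp0 : dp e @[e --> 0^'+] --> 0 by exact: (fine_cvg lp).
have dq0 : dq e @[e --> 0^'+] --> 0 by exact: (fine_cvg lq).
have /fine_cvgP[dpf _] := lp.
have /fine_cvgP[dqf _] := lq.
rewrite -(ler_pM2l c0_gt0).
(* U e is the error bound at scale e; it tends to the claimed bound times c0. *)
pose U e := c0 * (Num.sqrt (q - p + 2 * e) * L2norm `]a, b[ h) + 2 * dp e + 2 * dq e.
apply: (@cvgr_to_ge _ (0^'+) _ R U).
  rewrite distrC (ger0_norm (_ : 0 <= q - p)) ?subr_ge0//.
  rewrite [X in _ --> X](_ : _ =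
    c0 * (Num.sqrt (q - p + 2 * 0) * L2norm `]a, b[ h) + 2 * 0 + 2 * 0); last first.
    by rewrite !mulr0 !addr0.
  apply: cvgD; last by apply: cvgM; [exact: cvg_cst|exact: dq0].
  apply: cvgD; last by apply: cvgM; [exact: cvg_cst|exact: dp0].
  apply: cvgM; first exact: cvg_cst.
  apply: cvgM; last exact: cvg_cst.
  apply: (@continuous_cvg _ _ _ _ _ (fun e : R => q - p + 2 * e) Num.sqrt).
    exact: sqrt_continuous.
  apply: cvgD; first exact: cvg_cst.
  apply: cvgM; first exact: cvg_cst.
  exact: (cvg_at_right_filter cvg_id).
near=> e.
have e0 : 0 < e by [].
have ape : a < p - e.
  by rewrite ltrBrDl -ltrBrDr; near: e; apply: nbhs_right_lt; rewrite subr_gt0.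
have qeb : q + e < b.
  by rewrite -ltrBrDl; near: e; apply: nbhs_right_lt; rewrite subr_gt0.
have fdp : davg (g \_ `]a, b[) p e \is a fin_num by near: e.
have fdq : davg (g \_ `]a, b[) q e \is a fin_num by near: e.
have [mass /(_ p q pq ape qeb)[phi [tphi dphi phi_itv phi_out]]] := HT a b e e0.
have peb : p + e < b by apply: le_lt_trans qeb; rewrite lerD2r.
have aqe : a < q - e by apply: lt_le_trans ape _; rewrite lerD2r.
have Np := mollify_near e0 ape peb gi (mass p (ltW ape) (ltW peb)).
have Nq := mollify_near e0 aqe qeb gi (mass q (ltW aqe) (ltW qeb)).
have := gh _ tphi.
under eq_Rintegral => x _ do rewrite dphi mulrBr.
rewrite RintegralB//; last 2 first.
  exact: integrable_bounded_mfun mJ (bounded_mfun_rescaled_bump p mJ e0) gi.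
  exact: integrable_bounded_mfun mJ (bounded_mfun_rescaled_bump q mJ e0) gi.
set Ip := Rintegral _ _ _ in Np *; set Iq := Rintegral _ _ _ in Nq *.
set Ih := Rintegral _ _ _ => Ipq.
have {}Np : `|Ip - c0 * g p| <= 2 * dp e.
  by rewrite -lee_fin EFinM /dp fineK.
have {}Nq : `|Iq - c0 * g q| <= 2 * dq e.
  by rewrite -lee_fin EFinM /dq fineK.
have hle : `|Ih| <= c0 * (Num.sqrt (q - p + 2 * e) * L2norm `]a, b[ h).
  pose A : set R := [set` `[p - e, q + e]].
  have mA : measurable A by exact: measurable_itv.
  have AJ : A `<=` `]a, b[.
    move=> x; rewrite /A /= !in_itv/= => /andP[px xq].
    by rewrite (lt_le_trans ape px) (le_lt_trans xq qeb).
  have muA : mu A = (q - p + 2 * e)%:E.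
    rewrite /A /= lebesgue_measure_itv/= lte_fin ifT.
      by rewrite -EFinB; congr EFin; ring.
    by clear -pq e0; lra.
  have muAy : (mu A < +oo)%E by rewrite muA ltry.
  have hAi := L2_integrable mJ mA AJ muAy hL2.
  have mphi : measurable_fun setT phi.
    apply: continuous_measurable_fun; apply: derivable_continuous1 => x.
    exact: (tphi.1 0%N).
  have phi_le x : `|phi x| <= c0 by have /andP[? ?] := phi_itv x; rewrite ger0_norm.
  have -> : Ih = \int[mu]_(x in A) (h x * phi x).
    rewrite /Ih Rintegral_mkcond [RHS]Rintegral_mkcond; apply: eq_Rintegral => x _.
    rewrite /patch; have [xA|xA] := boolP (x \in A).
      by rewrite mem_set//; apply: AJ; rewrite inE in xA.
    case: ifP => // _; rewrite phi_out ?mulr0//.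
    by apply: contra xA => xA; exact/mem_set.
  have hphi : mu.-integrable A (EFin \o (fun x => h x * phi x)).
    apply: integrable_bounded_mfun hAi => //; split; first exact: measurable_funTS.
    by exists c0.
  apply: le_trans; first exact: (le_normr_Rintegral _ hphi).
  apply: (@le_trans _ _ (\int[mu]_(x in A) (c0 * `|h x|))).
    apply: le_Rintegral => //.
    - exact: (integrable_abse hphi).
    - exact: (integrableZl _ _ (integrable_abse hAi)).
    - by move=> x _; rewrite normrM mulrC ler_wpM2r.
  rewrite RintegralZl//; last exact: (integrable_abse hAi).
  rewrite ler_pM2l//.
  have := Rintegral_norm_le_L2 mJ mA AJ muAy hL2.
  by rewrite muA.
have -> : c0 * `|g p - g q| = `|c0 * g p - c0 * g q|.
  by rewrite -mulrBr normrM (gtr0_norm c0_gt0).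
have -> : c0 * g p - c0 * g q = - Ih - (Ip - c0 * g p) + (Iq - c0 * g q).
  by rewrite -Ipq; ring.
rewrite (le_trans (ler_normD _ _))// lerD//.
by rewrite (le_trans (ler_normB _ _))// lerD// normrN.
Unshelve. all: by end_near.
Qed.

Lemma ae_lebesgue_pt (a b : R) g : L2 `]a, b[ g ->
  {ae mu, forall p, lebesgue_pt (g \_ `]a, b[) p}.
Proof.
move=> gL2; have mJ : measurable [set` `]a, b[] by exact: measurable_itv.
apply: lebesgue_differentiation; apply: integrable_locally => //.
exact: (L2_integrable mJ mJ (@subset_refl _ _) (lebesgue_measure_oo_lty a b)).
Qed.

End Sobolev.

(** * The Hilbert transform away from the support *)

Section Hilbert.
Context {R : realType}.
Local Notation mu := (@lebesgue_measure R).
Implicit Types (J A : set R) (f g h k : R -> R).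

(** The truncated integrals are constant once the truncation is below the
    distance from x to J, so no principal value is involved. *)
Lemma hilbert_away J g (x del : R) : 0 < del ->
  (forall t, J t -> del <= `|x - t|) ->
  truncated_hilbert J g x = \int[mu]_(t in J) (g t / (x - t)).
Proof.
move=> del0 Jdel; rewrite /truncated_hilbert /hilbert.
apply: lim_near_cst; first exact: Rhausdorff.
near=> eps.
have epsd : eps < del by near: eps; exact: nbhs_right_lt.
rewrite Rintegral_mkcond [RHS]Rintegral_mkcond; apply: eq_Rintegral => t _.
rewrite /patch; have [tJ|tJ] := boolP (t \in J).
  rewrite mem_set//= (lt_le_trans epsd)// Jdel//.
  by rewrite inE in tJ.
by case: ifP => // _; rewrite mul0r.
Unshelve. all: by end_near.
Qed.

Lemma cauchy_transform_lipschitz J g (x y del : R) : measurable J -> 0 < del ->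
  (forall t, J t -> del <= `|t - x|) -> (forall t, J t -> del <= `|t - y|) ->
  mu.-integrable J (EFin \o g) ->
  `|\int[mu]_(t in J) (g t / (x - t)) - \int[mu]_(t in J) (g t / (y - t))|
   <= `|x - y| * (del ^- 2 * \int[mu]_(t in J) `|g t|).
Proof.
move=> mJ del0 Jx Jy gi.
have bdx := bounded_mfun_cauchy mJ del0 Jx.
have bdy := bounded_mfun_cauchy mJ del0 Jy.
have flip z t : g t / (z - t) = - 1 * (g t * (t - z)^-1).
  by rewrite mulN1r -mulrN -invrN opprB.
under eq_Rintegral do rewrite flip.
under [X in _ - X]eq_Rintegral do rewrite flip.
have ix := integrable_bounded_mfun mJ bdx gi.
have iy := integrable_bounded_mfun mJ bdy gi.
rewrite !RintegralZl// -mulrBr normrM normrN1 mul1r -RintegralB//.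
have -> : \int[mu]_(t in J) (g t / (t - x) - g t / (t - y)) =
   \int[mu]_(t in J) (g t * ((x - y) * ((t - x)^-1 * (t - y)^-1))).
  apply: eq_Rintegral => t; rewrite inE => Jt.
  have tx : t - x != 0 by rewrite -normr_gt0 (lt_le_trans del0)// Jx.
  have ty : t - y != 0 by rewrite -normr_gt0 (lt_le_trans del0)// Jy.
  by field; rewrite tx ty.
have ixy : mu.-integrable J (EFin \o (fun t => g t * ((x - y) * ((t - x)^-1 * (t - y)^-1)))).
  apply: integrable_bounded_mfun => //; apply: bounded_mfunM; first exact: bounded_mfun_cst.
  exact: bounded_mfunM.
have gai := integrable_abse gi.
apply: le_trans; first exact: (le_normr_Rintegral _ ixy).
apply: (@le_trans _ _ (\int[mu]_(t in J) ((`|x - y| * del ^- 2) * `|g t|))).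
  apply: le_Rintegral => //.
  - exact: (integrable_abse ixy).
  - exact: (integrableZl _ _ gai).
  - move=> t Jt; rewrite normrM mulrC ler_wpM2r// normrM ler_wpM2l//.
    rewrite normrM !normfV expr2 invfM ler_pM// ?invr_ge0// lef_pV2 ?posrE ?Jx ?Jy//.
      by rewrite (lt_le_trans del0)// Jx.
    by rewrite (lt_le_trans del0)// Jy.
by rewrite RintegralZl// mulrA.
Qed.

Lemma cauchy_transform_bound J g (x del : R) : measurable J -> 0 < del ->
  (forall t, J t -> del <= `|t - x|) -> mu.-integrable J (EFin \o g) ->
  `|\int[mu]_(t in J) (g t / (x - t))| <= del^-1 * \int[mu]_(t in J) `|g t|.
Proof.
move=> mJ del0 Jx gi.
have bdx := bounded_mfun_cauchy mJ del0 Jx.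
have flip t : g t / (x - t) = - 1 * (g t * (t - x)^-1).
  by rewrite mulN1r -mulrN -invrN opprB.
under eq_Rintegral do rewrite flip.
have ix := integrable_bounded_mfun mJ bdx gi.
have gai := integrable_abse gi.
rewrite RintegralZl// normrM normrN1 mul1r.
apply: le_trans; first exact: (le_normr_Rintegral _ ix).
rewrite -RintegralZl//; apply: le_Rintegral => //.
- exact: (integrable_abse ix).
- exact: (integrableZl _ _ gai).
- move=> t Jt; rewrite normrM mulrC ler_wpM2r// normfV lef_pV2 ?posrE ?Jx//.
  by rewrite (lt_le_trans del0)// Jx.
Qed.

(** The transform is Lipschitz and bounded on ]a, b[.  Hence [L2norm] is a true
    norm there, and not the value 0 to which [fine] sends an infinite one. *)
Lemma truncated_hilbert_L2 J g (a b del : R) : measurable J -> 0 < del ->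
  (forall x t, x \in `]a, b[ -> J t -> del <= `|t - x|) ->
  mu.-integrable J (EFin \o g) -> L2 `]a, b[ (truncated_hilbert J g).
Proof.
move=> mJ del0 Jdel gi.
have HE x : x \in `]a, b[ -> truncated_hilbert J g x = \int[mu]_(t in J) (g t / (x - t)).
  by move=> xI; apply: (@hilbert_away _ _ _ del) => // t Jt; rewrite distrC Jdel.
apply: (@bounded_L2 _ _ _ (del^-1 * \int[mu]_(t in J) `|g t|)).
- exact: measurable_itv.
- by rewrite /= lebesgue_measure_itv/= lte_fin; case: ifP => //; rewrite -EFinB ltry.
- apply: open_continuous_measurable_fun; first exact: interval_open.
  move=> x; rewrite inE/= => xI.
  set C := del ^- 2 * \int[mu]_(t in J) `|g t|.
  have C0 : 0 <= C.
    by rewrite mulr_ge0 ?Rintegral_ge0// invr_ge0 exprn_ge0// ltW.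
  apply/cvgrPdist_le => e e0; near=> y.
  have yI : y \in `]a, b[ by near: y; exact: near_in_itvoo.
  rewrite !HE//.
  apply: le_trans; first exact: (cauchy_transform_lipschitz mJ del0 (fun t => Jdel x t xI) (fun t => Jdel y t yI) gi).
  rewrite -/C.
  have h : `|x - y| <= e / (C + 1).
    near: y; apply: (@cvgr_dist_le _ R^o); [exact: cvg_id|].
    by rewrite divr_gt0// ltr_wpDl.
  have C1 : 0 < C + 1 by rewrite ltr_wpDl.
  rewrite (le_trans (ler_wpM2r C0 h))// mulrAC ler_pdivrMr// ler_pM2l//.
  by rewrite lerDl.
- move=> x xI; rewrite HE//; apply: cauchy_transform_bound => //.
  by move=> t; exact: Jdel.
Unshelve. all: by end_near.
Qed.

End Hilbert.

(** * Pairings with products of Cauchy kernels *)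

Section Kernel.
Context {R : realType}.
Local Notation mu := (@lebesgue_measure R).
Implicit Types (J A : set R) (f g h k : R -> R).

(** Otherwise |f| would exceed eps / sqrt lam on an interval of length lam, and
    the norm would be at least eps. *)
Lemma exists_small_value (a b u lam eps : R) f : L2 `]a, b[ f -> 0 < lam ->
  a <= u -> u + lam <= b -> L2norm `]a, b[ f < eps ->
  exists2 x, x \in `]u, u + lam[ & `|f x| <= eps / Num.sqrt lam.
Proof.
move=> fL2 lam0 au ub feps; apply: contrapT => Hno.
have eps0 : 0 < eps by apply: le_lt_trans feps; exact: L2norm_ge0.
have s0 : 0 < Num.sqrt lam by rewrite sqrtr_gt0.
have := @L2norm_ge_on _ `]a, b[ `]u, (u + lam)[ f (eps / Num.sqrt lam)
  (measurable_itv _) (measurable_itv _) _ _ fL2.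
have -> : mu `]u, (u + lam)[ = lam%:E.
  rewrite /= lebesgue_measure_itv/= lte_fin ltrDl lam0 -EFinB; congr EFin; ring.
rewrite -EFinM lee_fin expr_div_n (sqr_sqrtr (ltW lam0)) divfK ?gt_eqF// => H.
suff : eps ^+ 2 <= L2norm `]a, b[ f ^+ 2.
  by rewrite ler_sqr ?nnegrE ?L2norm_ge0 ?(ltW eps0)// leNgt feps.
apply: H.
- by apply: subset_itv; rewrite bnd_simp.
- by rewrite divr_ge0// ltW.
- move=> x xu; rewrite leNgt; apply/negP => h; apply: Hno; exists x => //.
  exact: ltW.
Qed.

Lemma bounded_mfun_cauchy_product J (X al be : nat -> R) (n : nat) (del : R) (s : seq nat) :
  measurable J -> 0 < del ->
  (forall i t, (i <= n)%N -> J t -> del <= `|t - X i|) ->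
  all (fun i => i <= n)%N s ->
  bounded_mfun J (fun t => \prod_(i <- s) (al i + be i / (t - X i))).
Proof.
move=> mJ del0 Jdel; elim: s => [_|i s IH /= /andP[ni /IH bs]].
  under eq_fun do rewrite big_nil; exact: bounded_mfun_cst.
under eq_fun do rewrite big_cons; apply: bounded_mfunM => //.
apply: bounded_mfunD; first exact: bounded_mfun_cst.
apply: bounded_mfunM; first exact: bounded_mfun_cst.
by apply: (@bounded_mfun_cauchy _ _ _ del) => // t; exact: Jdel.
Qed.

(** Partial fractions, one factor at a time: with y = X m and x = X i,
    1 / ((t - y) (t - x)) = (1 / (t - y) - 1 / (t - x)) / (y - x), so absorbing a
    factor leaves two shorter products, one based at y and one at x. *)
Lemma cauchy_product_bound J g (X al be : nat -> R) (n : nat) (del lam B eps : R) :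
  measurable J -> 0 < del -> 0 < lam -> 0 <= eps ->
  mu.-integrable J (EFin \o g) ->
  (forall i t, (i <= n)%N -> J t -> del <= `|t - X i|) ->
  (forall i j, (i <= n)%N -> (j <= n)%N -> i != j -> lam <= `|X i - X j|) ->
  (forall i, `|al i| + 2 * `|be i| / lam <= B) ->
  (forall i, (i <= n)%N -> `|\int[mu]_(t in J) (g t / (t - X i))| <= eps) ->
  forall (s : seq nat) (m : nat), uniq (m :: s) -> all (fun i => i <= n)%N (m :: s) ->
  `|\int[mu]_(t in J) (g t * ((t - X m)^-1 * \prod_(i <- s) (al i + be i / (t - X i))))|
    <= B ^+ size s * eps.
Proof.
move=> mJ del0 lam0 eps0 gi Jdel Xsep alB Heps.
have bcau i : (i <= n)%N -> bounded_mfun J (fun t => (t - X i)^-1).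
  by move=> ni; apply: (@bounded_mfun_cauchy _ _ _ del) => // t; exact: Jdel.
have bprod s := @bounded_mfun_cauchy_product J X al be n del s mJ del0 Jdel.
elim=> [m _ /= /andP[mn _]|x s IH m].
  rewrite expr0 mul1r; under eq_Rintegral do rewrite big_nil mulr1; exact: Heps.
rewrite [uniq _]/= [all _ _]/= inE negb_or => /andP[/andP[mx ms] /andP[xs us]].
move=> /andP[mn /andP[xn sn]].
have IHm : `|\int[mu]_(t in J) (g t * ((t - X m)^-1 * \prod_(i <- s) (al i + be i / (t - X i))))|
    <= B ^+ size s * eps.
  by apply: IH; rewrite /= ?ms ?mn.
have IHx : `|\int[mu]_(t in J) (g t * ((t - X x)^-1 * \prod_(i <- s) (al i + be i / (t - X i))))|
    <= B ^+ size s * eps.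
  by apply: IH; rewrite /= ?xs ?xn.
have mxsep : lam <= `|X m - X x| by exact: Xsep.
have Dmx0 : X m - X x != 0 by rewrite -normr_gt0 (lt_le_trans lam0).
set P := fun t : R => \prod_(i <- s) (al i + be i / (t - X i)) in IHm IHx *.
have im : mu.-integrable J (EFin \o (fun t => g t * ((t - X m)^-1 * P t))).
  apply: integrable_bounded_mfun => //; apply: bounded_mfunM; [exact: bcau|exact: bprod].
have ix : mu.-integrable J (EFin \o (fun t => g t * ((t - X x)^-1 * P t))).
  apply: integrable_bounded_mfun => //; apply: bounded_mfunM; [exact: bcau|exact: bprod].
set Im := Rintegral _ _ _ in IHm; set Ix := Rintegral _ _ _ in IHx.
pose ga := be x / (X m - X x).
have -> : \int[mu]_(t in J) (g t * ((t - X m)^-1 * \prod_(i <- x :: s) (al i + be i / (t - X i))))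
   = (al x + ga) * Im - ga * Ix.
  rewrite -!RintegralZl// -RintegralB//; last 2 first.
    exact: (integrableZl _ _ im).
    exact: (integrableZl _ _ ix).
  apply: eq_Rintegral => t; rewrite inE => Jt; rewrite big_cons -/(P t) /ga.
  have tm : t - X m != 0 by rewrite -normr_gt0 (lt_le_trans del0)// Jdel.
  have tx : t - X x != 0 by rewrite -normr_gt0 (lt_le_trans del0)// Jdel.
  by field; rewrite tm tx Dmx0.
have B0 : 0 <= B.
  by rewrite (le_trans _ (alB x))// addr_ge0// mulr_ge0 ?mulr_ge0// invr_ge0 ltW.
have gale : `|ga| <= `|be x| / lam.
  by rewrite /ga normrM normfV ler_wpM2l// lef_pV2 ?posrE// (lt_le_trans lam0).
have E0 : 0 <= B ^+ size s * eps by rewrite mulr_ge0// exprn_ge0.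
rewrite (le_trans (ler_normB _ _))// (normrM _ Im) (normrM ga Ix) [size _]/= exprS -mulrA.
apply: (@le_trans _ _ ((`|al x + ga| + `|ga|) * (B ^+ size s * eps))).
  by rewrite mulrDl; apply: lerD; apply: ler_wpM2l.
rewrite ler_wpM2r// (le_trans _ (alB x))//.
have := ler_normD (al x) ga.
move: gale; rewrite -mulrA; lra.
Qed.

End Kernel.

(** * A positive kernel peaked at a given point *)

Section PeakedKernel.
Context {R : realType}.
Implicit Types (u v m e sg kap : R).

(** The factors come in consecutive pairs, an odd and an even index; only the
    product over a pair is close to 1 - v^2. *)
Lemma prod_pairs_bounds (F : nat -> R) (lo hi : R) (N : nat) : 0 <= lo ->
  (forall j, (j < N)%N -> lo <= F j.*2.+1 * F j.*2.+2 <= hi) ->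
  lo ^+ N <= \prod_(i <- iota 1 N.*2) F i <= hi ^+ N.
Proof.
move=> lo0; elim: N => [_|N IH FN]; first by rewrite big_nil !expr0 lexx.
have /andP[IHl IHh] : lo ^+ N <= \prod_(i <- iota 1 N.*2) F i <= hi ^+ N.
  by apply: IH => j jN; apply: FN; rewrite ltnS ltnW.
have /andP[l h] := FN N (ltnSn N).
have -> : iota 1 N.+1.*2 = iota 1 N.*2 ++ [:: N.*2.+1; N.*2.+2].
  by rewrite doubleS -[X in iota 1 X = _]addn2 iotaD.
rewrite big_cat /= !big_cons big_nil mulr1 !exprSr; apply/andP; split.
  by rewrite ler_pM// exprn_ge0.
rewrite ler_pM//; first by rewrite (le_trans _ IHl)// exprn_ge0.
by rewrite (le_trans lo0).
Qed.

Lemma pair_bounds v e e' kap : `|v| <= 2^-1 -> 0 <= kap <= 1 ->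
  `|e| <= kap / 6 -> `|e'| <= kap / 6 ->
  1 - v ^+ 2 - kap / 2 <= (1 - (v + e)) * (1 + (v + e')) <= 1 - v ^+ 2 + kap / 2.
Proof.
move=> v2 /andP[n0 n1] he he'.
have -> : (1 - (v + e)) * (1 + (v + e')) =
   1 - v ^+ 2 + (e' * (1 - v) - e * (1 + v) - e * e') by ring.
rewrite -[1 - v ^+ 2 - kap / 2]/(1 - v ^+ 2 + - (kap / 2)) !lerD2l -ler_norml.
have [hw1 hw2] : 1 - v >= 0 /\ 1 + v >= 0.
  by move: v2; rewrite !ler_norml => /andP[? ?]; split; lra.
rewrite (le_trans (ler_normB _ _))// normrM.
have h1 : `|e' * (1 - v) - e * (1 + v)| <= kap / 6 * 2.
  rewrite (le_trans (ler_normB _ _))// !normrM (ger0_norm hw1) (ger0_norm hw2).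
  have := normr_ge0 e; have := normr_ge0 e'; nra.
have h2 : `|e| * `|e'| <= kap / 6 * 1.
  by rewrite ler_pM// (le_trans he')//; lra.
lra.
Qed.

(** With kap the square of the peak drop: up to v^2 = kap each of the N pairs is
    at least 1 - 3/2 kap, beyond v^2 = 4 kap it is at most
    1 - 7/2 kap <= (1 - 2 kap) (1 - 3/2 kap).  The N-th power turns the factor
    1 - 2 kap into an arbitrarily strong contrast. *)
Lemma peaked_product_bounds v kap (err : nat -> R) (N : nat) :
  `|v| <= 2^-1 -> 0 <= kap <= 4^-1 ->
  (forall i, (i <= N.*2)%N -> `|err i| <= kap / 6) ->
  let p := \prod_(i <- iota 1 N.*2) (1 + (-1) ^+ i * (v + err i)) in
  [/\ 0 <= p,
      v ^+ 2 <= kap -> (1 - 3 / 2 * kap) ^+ N <= p &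
      4 * kap <= v ^+ 2 -> p <= ((1 - 2 * kap) * (1 - 3 / 2 * kap)) ^+ N].
Proof.
move=> v_half /andP[kap0 kap4] e_le p.
have v4 : v ^+ 2 <= 4^-1.
  rewrite -real_normK ?num_real// (_ : 4^-1 = 2^-1 ^+ 2); last by field.
  by rewrite ler_sqr ?nnegrE ?invr_ge0.
have v0 := sqr_ge0 v.
have kap1 : kap <= 1 by lra.
have pairs lo hi : 0 <= lo -> lo <= 1 - v ^+ 2 - kap / 2 ->
    1 - v ^+ 2 + kap / 2 <= hi -> lo ^+ N <= p <= hi ^+ N.
  move=> lo0 lole lehi; apply: prod_pairs_bounds => // j jN.
  rewrite -(signr_odd _ j.*2.+1) -(signr_odd _ j.*2.+2) /= odd_double /= expr1 expr0.
  rewrite mulN1r mul1r.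
  have /andP[h1 h2] : 1 - v ^+ 2 - kap / 2 <=
      (1 - (v + err j.*2.+1)) * (1 + (v + err j.*2.+2)) <= 1 - v ^+ 2 + kap / 2.
    apply: pair_bounds => //; first by rewrite kap0 kap1.
      by apply: e_le; rewrite ltn_double.
    by apply: e_le; rewrite -doubleS leq_double.
  by rewrite (le_trans lole h1) (le_trans h2 lehi).
split.
- have /andP[+ _] := pairs 0 2 ltac:(lra) ltac:(lra) ltac:(lra).
  by apply: le_trans; exact: exprn_ge0.
- move=> vkap.
  by have /andP[] := pairs (1 - 3 / 2 * kap) 2 ltac:(lra) ltac:(lra) ltac:(lra).
- move=> vkap; have := sqr_ge0 kap => kap2.
  by have /andP[] := pairs 0 ((1 - 2 * kap) * (1 - 3 / 2 * kap))
    ltac:(lra) ltac:(lra) ltac:(lra).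
Qed.

Lemma inv_dist_le u v m : 0 < m -> m <= `|u| -> m <= `|v| ->
  `|u^-1 - v^-1| <= `|u - v| / m ^+ 2.
Proof.
move=> m0 mu mv.
have u0 : u != 0 by rewrite -normr_gt0 (lt_le_trans m0).
have v0 : v != 0 by rewrite -normr_gt0 (lt_le_trans m0).
have -> : u^-1 - v^-1 = (v - u) * (u^-1 * v^-1) by field; rewrite u0 v0.
rewrite normrM distrC ler_wpM2l// normrM !normfV expr2 invfM.
by rewrite ler_pM ?invr_ge0// lef_pV2 ?posrE ?normr_gt0.
Qed.

Lemma inv_dist_ge u v (M : R) : u != 0 -> v != 0 -> `|u| <= M -> `|v| <= M ->
  `|u - v| / M ^+ 2 <= `|u^-1 - v^-1|.
Proof.
move=> u0 v0 uM vM.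
have M0 : 0 < M by apply: lt_le_trans uM; rewrite normr_gt0.
have -> : u^-1 - v^-1 = (v - u) * (u^-1 * v^-1) by field; rewrite u0 v0.
rewrite normrM distrC ler_wpM2l// normrM !normfV expr2 invfM.
by rewrite ler_pM ?invr_ge0 ?(ltW M0)// lef_pV2 ?posrE ?normr_gt0.
Qed.

Lemma sign_inv sg u : `|sg| = 1 -> sg * u^-1 = (sg * u)^-1.
Proof.
move=> sg1; have sg0 : sg != 0 by rewrite -normr_gt0 sg1.
have sgsg : sg * sg = 1 by rewrite -expr2 -real_normK ?num_real// sg1 expr1n.
by rewrite invfM (_ : sg^-1 = sg)//; apply: (mulfI sg0); rewrite sgsg mulfV.
Qed.

Lemma inv_dist_same_sign u v m sg : `|sg| = 1 -> 0 < m -> m <= sg * u -> m <= sg * v ->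
  `|u^-1 - v^-1| <= m^-1.
Proof.
move=> sg1 m0 mu mv.
rewrite -[leLHS]mul1r -sg1 -normrM mulrBr !sign_inv//.
have u0 : 0 < sg * u by exact: lt_le_trans mu.
have v0 : 0 < sg * v by exact: lt_le_trans mv.
have : (sg * u)^-1 <= m^-1 by rewrite lef_pV2.
have : (sg * v)^-1 <= m^-1 by rewrite lef_pV2.
have : 0 < (sg * u)^-1 by rewrite invr_gt0.
have : 0 < (sg * v)^-1 by rewrite invr_gt0.
by rewrite ler_norml => ? ? ? ?; apply/andP; split; lra.
Qed.

(** The factor with index i is 1 + (-1)^i v_i, where
    v_i = rho / 2 (1 / (t - X i) - 1 / (t0 - x0)), written as an affine function
    of 1 / (t - X i). *)
Definition kernel_shift (rho : R) (t0 x0 : R) (i : nat) : R :=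
  1 - (-1) ^+ i * (rho / 2) * (t0 - x0)^-1.

Definition kernel_slope (rho : R) (i : nat) : R := (-1) ^+ i * (rho / 2).

Definition peaked_kernel (rho t0 x0 : R) (X : nat -> R) (N : nat) (t : R) : R :=
  (t - X 0%N)^-1 *
  \prod_(i <- iota 1 N.*2) (kernel_shift rho t0 x0 i + kernel_slope rho i / (t - X i)).

(** Here sg is the common sign of the differences t - x for x in I and t in J,
    and rl and Sl bound |t - x| from below and from above.  The map t |-> 1 / (t - x0) distorts distances by
    factors between Sl^-2 and rl^-2; this is why the peak is only known to be
    high on a radius d1 much smaller than the radius d2 outside of which it is
    known to be low. *)
Lemma peaked_kernel_bounds (t0 t x0 rl Sl nu sg d1 d2 : R) (X : nat -> R) (N : nat) :
  `|sg| = 1 -> 0 < rl -> 0 <= nu <= 2^-1 ->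
  rl <= sg * (t - x0) <= Sl -> rl <= sg * (t0 - x0) <= Sl ->
  (forall i, (i <= N.*2)%N -> rl <= sg * (t - X i) <= Sl) ->
  (forall i, (i <= N.*2)%N -> `|X i - x0| <= nu ^+ 2 * rl / 3) ->
  d1 / (2 * rl) <= nu -> 2 * nu <= d2 * rl / (2 * Sl ^+ 2) ->
  let K := sg * peaked_kernel rl t0 x0 X N t in
  [/\ 0 <= K,
      `|t - t0| <= d1 -> (1 - 3 / 2 * nu ^+ 2) ^+ N / Sl <= K &
      d2 <= `|t - t0| ->
        K <= ((1 - 2 * nu ^+ 2) * (1 - 3 / 2 * nu ^+ 2)) ^+ N / rl].
Proof.
move=> sg1 rl0 /andP[nu0 nu2] /andP[tx0 tx0'] /andP[t0x0 t0x0'] tX Xx0 d1nu d2nu K.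
have nrm u : rl <= sg * u <= Sl -> rl <= `|u| <= Sl.
  move=> /andP[h1 h2]; rewrite -[`|u|]mul1r -sg1 -normrM ger0_norm ?h1//.
  exact: le_trans (ltW rl0) h1.
have /andP[ntx0 ntx0'] := nrm _ (introT andP (conj tx0 tx0')).
have /andP[nt0x0 nt0x0'] := nrm _ (introT andP (conj t0x0 t0x0')).
have ntX i (iN : (i <= N.*2)%N) := nrm _ (tX i iN).
have Sl0 : 0 < Sl by rewrite (lt_le_trans rl0)// (le_trans tx0).
have rl20 : 0 < rl / 2 by rewrite divr_gt0.
pose v := rl / 2 * ((t - x0)^-1 - (t0 - x0)^-1).
pose e i := rl / 2 * ((t - X i)^-1 - (t - x0)^-1).
have v_half : `|v| <= 2^-1.
  rewrite /v normrM (gtr0_norm rl20).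
  have := inv_dist_same_sign sg1 rl0 tx0 t0x0.
  move=> /(ler_wpM2l (ltW rl20)); rewrite (_ : rl / 2 * rl^-1 = 2^-1)//.
  by field; rewrite gt_eqF.
have dtt0 : t - x0 - (t0 - x0) = t - t0 by ring.
have e_le i : (i <= N.*2)%N -> `|e i| <= nu ^+ 2 / 6.
  move=> iN; have /andP[h _] := ntX i iN.
  rewrite /e normrM (gtr0_norm rl20).
  apply: (le_trans (ler_wpM2l (ltW rl20) (inv_dist_le rl0 h ntx0))).
  have -> : t - X i - (t - x0) = - (X i - x0) by ring.
  have -> : nu ^+ 2 / 6 = rl / 2 * (nu ^+ 2 * rl / 3 / rl ^+ 2).
    by field; rewrite gt_eqF.
  by rewrite normrN ler_pM2l// ler_pM2r ?invr_gt0 ?exprn_gt0// Xx0.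
have nu24 : 0 <= nu ^+ 2 <= 4^-1.
  rewrite sqr_ge0 (_ : 4^-1 = 2^-1 ^+ 2); last by field.
  by rewrite ler_sqr ?nnegrE ?invr_ge0.
have [p0 pnear pfar] := peaked_product_bounds v_half nu24 e_le.
set p := \prod_(i <- _) _ in p0 pnear pfar.
have KE : K = (sg * (t - X 0%N))^-1 * p.
  rewrite /K mulrA sign_inv//; congr (_ * _); apply: eq_bigr => i _.
  by rewrite /kernel_shift /kernel_slope /v /e; ring.
have /andP[q1 q2] := tX 0%N isT.
have q0 : 0 < sg * (t - X 0%N) by exact: lt_le_trans q1.
have qV0 : 0 <= (sg * (t - X 0%N))^-1 by rewrite invr_ge0 ltW.
rewrite KE; split; first exact: mulr_ge0.
- move=> tt0; rewrite mulrC; apply: ler_pM => //; first by rewrite invr_ge0 ltW.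
    by apply: exprn_ge0; move: nu24 => /andP[_ h]; lra.
    by rewrite lef_pV2.
  apply: pnear; rewrite -(real_normK (num_real v)) ler_sqr ?nnegrE//.
  apply: le_trans d1nu; rewrite /v normrM (gtr0_norm rl20).
  apply: (le_trans (ler_wpM2l (ltW rl20) (inv_dist_le rl0 ntx0 nt0x0))).
  have -> : d1 / (2 * rl) = rl / 2 * (d1 / rl ^+ 2) by field; rewrite gt_eqF.
  by rewrite dtt0 ler_pM2l// ler_pM2r ?invr_gt0 ?exprn_gt0.
- move=> tt0; rewrite [leRHS]mulrC; apply: ler_pM => //; first by rewrite lef_pV2.
  apply: pfar; rewrite -(real_normK (num_real v)) (_ : 4 * nu ^+ 2 = (2 * nu) ^+ 2); last by ring.
  rewrite ler_sqr ?nnegrE ?mulr_ge0//.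
  apply: (le_trans d2nu); rewrite /v normrM (gtr0_norm rl20).
  have n1 : t - x0 != 0 by rewrite -normr_gt0 (lt_le_trans rl0).
  have n2 : t0 - x0 != 0 by rewrite -normr_gt0 (lt_le_trans rl0).
  apply: le_trans (ler_wpM2l (ltW rl20) (inv_dist_ge n1 n2 ntx0' nt0x0')).
  have -> : d2 * rl / (2 * Sl ^+ 2) = rl / 2 * (d2 / Sl ^+ 2) by field; rewrite gt_eqF.
  by rewrite dtt0 ler_pM2l// ler_pM2r ?invr_gt0 ?exprn_gt0.
Qed.

End PeakedKernel.

(** * Integrating against a peaked kernel *)

Section PeakIntegral.
Context {R : realType}.
Local Notation mu := (@lebesgue_measure R).
Implicit Types (g K : R -> R).

(** Taken to the right or to the left of t0, whichever stays in ]c, d[. *)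
Lemma interval_near_point (c d t0 w : R) : t0 \in `]c, d[ -> 0 < w -> w <= (d - c) / 2 ->
  exists u, [/\ c <= u, u + w <= d & forall t, t \in `]u, u + w[ -> `|t - t0| <= w].
Proof.
rewrite in_itv/= => /andP[ct0 t0d] w0 wcd.
have [h|h] := leP (t0 + w) d.
  exists t0; split => //; first exact: ltW.
  by move=> t; rewrite in_itv/= ler_norml => /andP[? ?]; apply/andP; split; lra.
exists (t0 - w); split; [lra|lra|].
by move=> t; rewrite in_itv/= ler_norml => /andP[? ?]; apply/andP; split; lra.
Qed.

Lemma Rintegral_setD_null (J E : set R) g : measurable J -> measurable E -> mu E = 0 ->
  mu.-integrable J (EFin \o g) ->
  \int[mu]_(t in J) g t = \int[mu]_(t in J `\` E) g t.
Proof. by move=> mJ mE E0 gi; rewrite /Rintegral (@negligible_integral _ _ _ mu _ E). Qed.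

(** Up to the sign of g t0, the integrand is at least |g t0| lo / 2 on an interval
    of length w, nonnegative up to distance w' of t0, and at least
    - B |g t0| hi beyond. *)
Lemma peak_integral_ge (c d t0 w w' lo hi B : R) (E : set R) g K :
  t0 \in `]c, d[ -> 0 < w -> w <= (d - c) / 2 -> w <= w' -> 0 <= lo -> 0 <= hi -> 0 <= B ->
  measurable E -> mu E = 0 ->
  bounded_mfun `]c, d[ K -> mu.-integrable `]c, d[ (EFin \o g) ->
  (forall t, t \in `]c, d[ ->
    [/\ 0 <= K t, `|t - t0| <= w -> lo <= K t & w' <= `|t - t0| -> K t <= hi]) ->
  (forall t, t \in `]c, d[ -> ~ E t -> `|t - t0| <= w' -> `|g t - g t0| <= `|g t0| / 2) ->
  (forall t, t \in `]c, d[ -> ~ E t -> `|g t| <= B * `|g t0|) ->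
  `|g t0| * (lo / 2 * w - B * hi * (d - c)) <= `|\int[mu]_(t in `]c, d[) (g t * K t)|.
Proof.
move=> t0J w0 wcd ww' lo0 hi0 B0 mE muE bK gi Kb gnear gB.
have mJ : measurable [set` `]c, d[] by exact: measurable_itv.
have cd : c < d by move: t0J; rewrite in_itv/= => /andP[]; exact: lt_trans.
have gKi := integrable_bounded_mfun mJ bK gi.
pose m := `|g t0|.
pose s0 := Num.sg (g t0).
have m0 : 0 <= m by exact: normr_ge0.
have s0_le : `|s0| <= 1 by rewrite normr_sg lern1 leq_b1.
pose a := m / 2 * lo.
pose b := B * m * hi.
have b0 : 0 <= b by rewrite !mulr_ge0.
have [u [cu ud ut0]] := interval_near_point t0J w0 wcd.
pose A : set R := [set` `]u, u + w[].
have AJ : A `<=` `]c, d[ by apply: subset_itv; rewrite bnd_simp.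
have mA : measurable [set` `]u, u + w[] by exact: measurable_itv.
pose low t := a * \1_A t - b.
have low_le t : t \in `]c, d[ -> ~ E t -> low t <= s0 * (g t * K t).
  move=> tJ Et; rewrite mulrA.
  have [K0 Knear Kfar] := Kb t tJ.
  have [tt0|tt0] := leP `|t - t0| w'.
    have sgt : m / 2 <= s0 * g t.
      have -> : s0 * g t = m + s0 * (g t - g t0) by rewrite /m normrEsg /s0; ring.
      have : `|s0 * (g t - g t0)| <= m / 2.
        by rewrite normrM (le_trans _ (gnear t tJ Et tt0))// ler_piMl.
      by rewrite ler_norml => /andP[h _]; clear -h; lra.
    have m20 : 0 <= m / 2 by rewrite divr_ge0.
    rewrite /low indicE; have [tA|_] := boolP (t \in A).
      rewrite mulr1; apply: (@le_trans _ _ a); first by rewrite gerBl.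
      by apply: ler_pM => //; apply: Knear; apply: ut0; rewrite inE in tA.
    rewrite mulr0 sub0r; apply: (@le_trans _ _ 0); first by rewrite oppr_le0.
    by apply: mulr_ge0 => //; exact: le_trans sgt.
  have -> : low t = - b.
    rewrite /low indicE; have [tA|_] := boolP (t \in A); last by rewrite mulr0 sub0r.
    rewrite inE in tA; have := lt_le_trans tt0 (ut0 t tA).
    by rewrite ltNge ww'.
  have : `|s0 * g t * K t| <= b.
    rewrite normrM (ger0_norm K0); apply: ler_pM => //; last exact: Kfar (ltW tt0).
    by rewrite normrM (le_trans _ (gB t tJ Et))// ler_piMl.
  by rewrite ler_norml => /andP[].
have muJ : mu `]c, d[ = (d - c)%:E.
  by rewrite /= lebesgue_measure_itv/= lte_fin cd -EFinB.
have muJy : (mu `]c, d[ < +oo)%E by rewrite muJ ltry.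
have muA : mu A = w%:E.
  rewrite /A /= lebesgue_measure_itv/= lte_fin ltrDl w0 -EFinB.
  by congr EFin; rewrite addrC addKr.
have bind : bounded_mfun `]c, d[ (\1_A : R -> R).
  split; first exact: measurable_indic.
  by exists 1 => t _; rewrite indicE ger0_norm//; case: (t \in A).
have csti (z : R) : mu.-integrable `]c, d[ (EFin \o cst z) by exact: bounded_mfun_integrable (bounded_mfun_cst _ z).
have indi : mu.-integrable `]c, d[ (EFin \o (\1_A : R -> R)) by exact: bounded_mfun_integrable bind.
have aindi : mu.-integrable `]c, d[ (EFin \o (fun t => a * \1_A t)) by exact: (integrableZl _ _ indi).
have lowi : mu.-integrable `]c, d[ (EFin \o low).
  have -> : EFin \o low = ((EFin \o (fun t => (a * \1_A t)%R)) \- (EFin \o cst b))%E.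
    by apply/funext => t; rewrite /= EFinB.
  exact: integrableB.
have lowI : \int[mu]_(t in `]c, d[) low t = a * w - b * (d - c).
  rewrite RintegralB//; last exact: csti.
  rewrite RintegralZl// Rintegral_cst//; congr (_ * _ - _ * _).
    rewrite /Rintegral integral_indic//.
    by rewrite setIidl//; exact: (congr1 fine muA).
  exact: (congr1 fine muJ).
have s0gKi : mu.-integrable `]c, d[ (EFin \o (fun t => s0 * (g t * K t))).
  exact: (integrableZl _ _ gKi).
have main : \int[mu]_(t in `]c, d[) low t <= \int[mu]_(t in `]c, d[) (s0 * (g t * K t)).
  have mJE : measurable ([set` `]c, d[] `\` E) by exact: measurableD.
  rewrite (Rintegral_setD_null mJ mE muE lowi) (Rintegral_setD_null mJ mE muE s0gKi).
  apply: le_Rintegral.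
  - exact: measurableD.
  - by apply: integrableS lowi => //; exact: measurableD.
  - by apply: integrableS s0gKi => //; exact: measurableD.
  - by move=> t [tJ Et]; exact: low_le.
rewrite RintegralZl// lowI in main.
have -> : m * (lo / 2 * w - B * hi * (d - c)) = a * w - b * (d - c).
  by rewrite /a /b; ring.
apply: (le_trans main); apply: (le_trans (ler_norm _)).
by rewrite normrM ler_piMl.
Qed.

End PeakIntegral.

(** * Geometry of the two intervals and choice of the nodes *)

Section Assembly.
Context {R : realType}.
Local Notation mu := (@lebesgue_measure R).
Implicit Types (f g h : R -> R).

(** A positive distance forces the intervals to be disjoint; the sign sg records
    on which side of ]a, b[ the interval ]c, d[ lies. *)
Lemma separated_intervals (a b c d r s : R) : a < b -> c < d -> 0 < r ->
  relative_size a b c d = s -> relative_distance a b c d = r ->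
  b - a = s * (d - c) /\
  exists2 sg : R, `|sg| = 1 & forall x t, x \in `]a, b[ -> t \in `]c, d[ ->
    r * (d - c) <= sg * (t - x) <= (1 + r + s) * (d - c).
Proof.
move=> ab cd r0 <- rd.
have l0 : 0 < d - c by rewrite subr_gt0.
have bsl : b - a = relative_size a b c d * (d - c) by rewrite /relative_size divfK// gt_eqF.
split=> //.
have rl : set_dist `]a, b[ `]c, d[ = r * (d - c) by rewrite -rd /relative_distance divfK// gt_eqF.
have dist_ge x t : x \in `]a, b[ -> t \in `]c, d[ -> r * (d - c) <= `|x - t|.
  move=> xI tJ; rewrite -rl; apply: ge_inf.
    by exists 0 => _ [y _ [z _ <-]].
  by exists x => //; exists t.
have dist_ub (m : R) : (forall x t, x \in `]a, b[ -> t \in `]c, d[ -> m <= `|x - t|) ->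
    m <= r * (d - c).
  move=> H; rewrite -rl; apply: lb_le_inf.
    exists `|(a + b) / 2 - (c + d) / 2|.
    exists ((a + b) / 2); first by rewrite /= in_itv/= midf_lt// midf_lt.
    by exists ((c + d) / 2) => //; rewrite /= in_itv/= midf_lt// midf_lt.
  by move=> _ [y yI [z zJ <-]]; exact: H.
have rl0 : 0 < r * (d - c) by exact: mulr_gt0.
have [bc|cb] := leP b c.
  exists 1; first by rewrite normr1.
  have cbr : c - b <= r * (d - c).
    apply: dist_ub => x t; rewrite !in_itv/= => /andP[? ?] /andP[? ?].
    by rewrite distrC ger0_norm; lra.
  move=> x t xI tJ; have := dist_ge x t xI tJ.
  move: xI tJ; rewrite !in_itv/= => /andP[? ?] /andP[? ?].
  by rewrite distrC ger0_norm; lra.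
have [da|ad] := leP d a.
  exists (-1); first by rewrite normrN1.
  have adr : a - d <= r * (d - c).
    apply: dist_ub => x t; rewrite !in_itv/= => /andP[? ?] /andP[? ?].
    by rewrite ger0_norm; lra.
  move=> x t xI tJ; have := dist_ge x t xI tJ.
  move: xI tJ; rewrite !in_itv/= => /andP[? ?] /andP[? ?].
  by rewrite ger0_norm; lra.
pose z := (Num.max a c + Num.min b d) / 2.
have zz : Num.max a c < z < Num.min b d.
  by rewrite !midf_lt// lt_min !gt_max ab cd cb ad.
have zI : z \in `]a, b[.
  rewrite in_itv/=; move: zz; rewrite gt_max lt_min => /andP[/andP[-> _] /andP[-> _]]//.
have zJ : z \in `]c, d[.
  rewrite in_itv/=; move: zz; rewrite gt_max lt_min => /andP[/andP[_ ->] /andP[_ ->]]//.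
by have := dist_ge z z zI zJ; rewrite subrr normr0 leNgt rl0.
Qed.

(** The node X i is taken in the cell ]a + 2 i lam, a + 2 i lam + lam[; the gaps
    between the cells keep the nodes at distance lam. *)
Lemma exists_nodes (a b lam eps : R) (n : nat) f : L2 `]a, b[ f -> 0 < lam ->
  a + n.*2.+1%:R * lam <= b -> L2norm `]a, b[ f < eps ->
  exists X : nat -> R, [/\ forall i, (i <= n)%N -> X i \in `]a, b[,
    forall i, (i <= n)%N -> `|X i - X 0%N| <= n.*2.+1%:R * lam,
    forall i j, (i <= n)%N -> (j <= n)%N -> i != j -> lam <= `|X i - X j| &
    forall i, (i <= n)%N -> `|f (X i)| <= eps / Num.sqrt lam].
Proof.
move=> fL2 lam0 nb feps.
have /choice[X HX] : forall i : nat, exists x, (i <= n)%N ->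
    (x \in `]a + i.*2%:R * lam, a + i.*2%:R * lam + lam[) /\ `|f x| <= eps / Num.sqrt lam.
  move=> i; have [ni|_] := leqP i n; last by exists 0.
  have : i.*2.+1%:R * lam <= n.*2.+1%:R * lam.
    by rewrite ler_pM2r// ler_nat ltnS leq_double.
  rewrite -natr1 mulrDl mul1r => h.
  have [|||x xI fx] := @exists_small_value R a b (a + i.*2%:R * lam) lam eps f fL2 lam0.
  - by rewrite lerDl mulr_ge0// ltW.
  - lra.
  - exact: feps.
  by exists x.
have Xlt i : (i <= n)%N -> a + i.*2%:R * lam < X i < a + i.*2.+1%:R * lam.
  by move=> ni; have [] := HX i ni; rewrite in_itv/= -(natr1 i.*2) mulrDl mul1r addrA.
have step i j : (i <= j)%N -> i%:R * lam <= j%:R * lam :> R.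
  by move=> ij; rewrite ler_pM2r// ler_nat.
exists X; split.
- move=> i ni; have /andP[h1 h2] := Xlt i ni; rewrite in_itv/=.
  have := step 0%N i.*2 isT; have := @step i.*2.+1 n.*2.+1.
  rewrite ltnS leq_double mul0r => /(_ ni) ? ?; apply/andP; split; lra.
- move=> i ni; have /andP[h1 h2] := Xlt i ni; have /andP[h3 h4] := Xlt 0%N isT.
  have := step 0%N i.*2 isT; have := @step i.*2.+1 n.*2.+1; have := @step 1%N n.*2.+1 isT.
  rewrite ltnS leq_double mul0r => h5 /(_ ni) h6 h7.
  by rewrite ler_norml; move: h3 h4; rewrite double0 mul0r => h3 h4; apply/andP; split; lra.
- have sep i j : (i <= n)%N -> (j <= n)%N -> (i < j)%N -> lam <= X j - X i.
    move=> ni nj ij; have /andP[h1 h2] := Xlt i ni; have /andP[h3 h4] := Xlt j nj.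
    have : i.*2.+2%:R * lam <= j.*2%:R * lam by apply: step; rewrite -doubleS leq_double.
    rewrite -(natr1 i.*2.+1) mulrDl mul1r; lra.
  move=> i j ni nj; rewrite neq_ltn => /orP[ij|ji].
    by rewrite distrC (le_trans (sep i j ni nj ij))// ler_norm.
  by rewrite (le_trans (sep j i nj ni ji))// ler_norm.
- by move=> i ni; have [] := HX i ni.
Qed.

(** If |g| were smaller than half its quadratic mean outside of a null set, its
    norm would be at most half of itself. *)
Lemma exists_large_value (c d : R) (E : set R) g : c < d -> L2 `]c, d[ g ->
  measurable E -> mu E = 0 -> 0 < L2norm `]c, d[ g ->
  exists t, [/\ t \in `]c, d[, ~ E t & L2norm `]c, d[ g <= 2 * Num.sqrt (d - c) * `|g t|].
Proof.
move=> cd gL2 mE muE g0; apply: contrapT => Hno.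
have l0 : 0 < d - c by rewrite subr_gt0.
have s0 : 0 < Num.sqrt (d - c) by rewrite sqrtr_gt0.
pose k := L2norm `]c, d[ g / (2 * Num.sqrt (d - c)).
have k0 : 0 < k by rewrite divr_gt0// mulr_gt0.
have gk t : t \in `]c, d[ -> ~ E t -> `|g t| <= k.
  move=> tJ Et; rewrite leNgt; apply/negP => h; apply: Hno; exists t; split => //.
  by rewrite mulrC -ler_pdivrMr ?mulr_gt0// ltW.
have mJ : measurable [set` `]c, d[] by exact: measurable_itv.
have mg : measurable_fun `]c, d[ g.
  by apply/(measurable_restrictT _ mJ); exact: L2_measurable.
have muJ : mu `]c, d[ = (d - c)%:E.
  by rewrite /= lebesgue_measure_itv/= lte_fin cd -EFinB.
have := L2norm_sqr gL2.
have -> : (\int[mu]_(x in `]c, d[) (g x ^+ 2)%:E = \int[mu]_(x in `]c, d[ `\` E) (g x ^+ 2)%:E)%E.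
  apply: ge0_negligible_integral => //.
  - exact/measurable_EFinP/measurable_funX.
  - by move=> x _; rewrite lee_fin sqr_ge0.
move=> H.
have : ((L2norm `]c, d[ g ^+ 2)%:E <= (k ^+ 2)%:E * (d - c)%:E)%E.
  rewrite -muJ -integral_cst// H.
  apply: (@le_trans _ _ (\int[mu]_(x in `]c, d[ `\` E) (k ^+ 2)%:E)%E); last first.
    apply: ge0_subset_integral => //; first exact: measurableD.
    by move=> x _; rewrite lee_fin sqr_ge0.
  apply: ge0_le_integral => //.
  - exact: measurableD.
  - by move=> x _; rewrite lee_fin sqr_ge0.
  - apply/measurable_EFinP/measurable_funX; apply: measurable_funS mg => //.
  - move=> x [xJ Ex]; rewrite lee_fin -real_normK ?num_real// ler_sqr ?nnegrE ?gk//.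
    exact: ltW.
rewrite -EFinM lee_fin expr_div_n exprMn (sqr_sqrtr (ltW l0)).
have g2 : 0 < L2norm `]c, d[ g ^+ 2 by rewrite exprn_gt0.
rewrite (_ : L2norm `]c, d[ g ^+ 2 / (2 ^+ 2 * (d - c)) * (d - c) = L2norm `]c, d[ g ^+ 2 / 4).
  lra.
by field; rewrite gt_eqF.
Qed.

Lemma le_mul_of_gt (x K y : R) : 0 < K -> (forall z, y < z -> x <= K * z) -> x <= K * y.
Proof.
move=> K0 H; apply/ler_addgt0Pr => e e0.
have -> : K * y + e = K * (y + e / K) by field; rewrite gt_eqF.
by apply: H; rewrite ltrDl divr_gt0.
Qed.

Lemma bounded_mfun_peaked_kernel (J : set R) (X : nat -> R) (N : nat) (t0 rl : R) :
  measurable J -> 0 < rl ->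
  (forall i t, (i <= N.*2)%N -> J t -> rl <= `|t - X i|) ->
  bounded_mfun J (peaked_kernel rl t0 (X 0%N) X N).
Proof.
move=> mJ rl0 Jrl; apply: bounded_mfunM.
  by apply: (@bounded_mfun_cauchy _ _ _ rl) => // t; exact: Jrl.
apply: (@bounded_mfun_cauchy_product _ _ X _ _ N.*2 rl) => //.
by apply/allP => i; rewrite mem_iota => /andP[_]; rewrite add1n ltnS.
Qed.

(** The shift of each factor is at most 3/2 in modulus because |t0 - x0| is at
    least rl. *)
Lemma peaked_kernel_pairing (J : set R) (X : nat -> R) (N : nat) (t0 rl lam eps : R) g :
  measurable J -> mu.-integrable J (EFin \o g) -> 0 < rl -> 0 < lam -> 0 <= eps -> J t0 ->
  (forall i t, (i <= N.*2)%N -> J t -> rl <= `|t - X i|) ->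
  (forall i j, (i <= N.*2)%N -> (j <= N.*2)%N -> i != j -> lam <= `|X i - X j|) ->
  (forall i, (i <= N.*2)%N -> `|truncated_hilbert J g (X i)| <= eps) ->
  `|\int[mu]_(t in J) (g t * peaked_kernel rl t0 (X 0%N) X N t)|
    <= (3 / 2 + rl / lam) ^+ N.*2 * eps.
Proof.
move=> mJ gi rl0 lam0 eps0 Jt0 Jrl Xsep Xval.
have := @cauchy_product_bound R J g X (kernel_shift rl t0 (X 0%N)) (kernel_slope rl) N.*2
  rl lam (3 / 2 + rl / lam) eps mJ rl0 lam0 eps0 gi Jrl Xsep _ _ (iota 1 N.*2) 0%N.
rewrite size_iota; apply.
- move=> i; rewrite /kernel_shift /kernel_slope -mulrA.
  have rl20 : 0 < rl / 2 by rewrite divr_gt0.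
  have -> : 2 * `|(-1) ^+ i * (rl / 2)| / lam = rl / lam.
    by rewrite normrMsign (gtr0_norm rl20); field; rewrite gt_eqF.
  rewrite lerD2r (le_trans (ler_normB _ _))// normr1 normrMsign normrM (gtr0_norm rl20).
  have : `|(t0 - X 0%N)^-1| <= rl^-1.
    have t0X := Jrl 0%N t0 isT Jt0.
    by rewrite normfV lef_pV2 ?posrE// (lt_le_trans rl0).
  move=> /(ler_wpM2l (ltW rl20)); rewrite (_ : rl / 2 * rl^-1 = 2^-1).
    by move=> h; clear -h; lra.
  by field; rewrite gt_eqF.
- move=> i iN; have := Xval i iN.
  have Ji t : J t -> rl <= `|t - X i| by exact: Jrl.
  rewrite (@hilbert_away _ _ _ _ rl)//; last by move=> t Jt; rewrite distrC; exact: Ji.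
  have flip t : g t / (X i - t) = - 1 * (g t * (t - X i)^-1).
    by rewrite mulN1r -mulrN -invrN opprB.
  under eq_Rintegral do rewrite flip.
  rewrite RintegralZl ?normrM ?normrN1 ?mul1r//.
  exact: (integrable_bounded_mfun mJ (bounded_mfun_cauchy mJ rl0 Ji) gi).
- by rewrite /= iota_uniq andbT mem_iota.
- by apply/allP => i; rewrite inE mem_iota => /predU1P[->//|/andP[_]]; rewrite add1n ltnS.
Qed.

End Assembly.

(** * The scales of the construction

    All lengths are measured in units of |J|; r and s are the relative distance
    and size of the intervals, L bounds |J|, and q is the ratio of the norms of
    g in H^1 and in L^2. *)

Section Scales.
Context {R : realType}.
Implicit Types (r s L q l m eta : R).

(** Within this radius of t0 the oscillation of g is at most |g t0| / 2. *)
Definition hoelder_radius L q := (16 * (1 + L ^+ 2) * q ^+ 2)^-1.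

(** The smaller radius on which the kernel is close to its maximum; the factor
    (r / (1 + r + s))^2 accounts for the distortion of distances by
    t |-> 1 / (t - x). *)
Definition peak_radius r s L q := hoelder_radius L q * r ^+ 2 / (2 * (1 + r + s) ^+ 2).

(** The bound on |v| that [peak_radius] guarantees; at [hoelder_radius], |v| is
    at least twice as large. *)
Definition peak_drop r s L q := peak_radius r s L q / (2 * r).

(** The length of the part of I where the nodes are taken.  The factor
    s / (1 + s) keeps it below s, so that the nodes fit in I, and the rest makes
    the perturbation of v at most a sixth of the square of [peak_drop]. *)
Definition node_spread r s L q := s / (1 + s) * (peak_drop r s L q ^+ 2 * r / 3).

(** The nodes 0, ..., 2N occupy every other one of 4N + 1 consecutive cells of
    equal length; this is the inverse of that length. *)
Definition inv_cell r s L q (N : nat) := N.*2.*2.+1%:R / node_spread r s L q.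

(** This times |g t0| bounds |g|: the oscillation of g over J is at most
    sqrt |J| times the norm of the weak derivative. *)
Definition sup_ratio L q := 1 + 2 * L * q.

Lemma hoelder_radius_itv L q : 1 <= q -> 0 < hoelder_radius L q <= 1.
Proof.
move=> q1; have L20 := sqr_ge0 L; have q21 : 1 <= q ^+ 2 by exact: exprn_ege1.
have den : 1 <= 16 * (1 + L ^+ 2) * q ^+ 2 by nra.
have den0 : 0 < 16 * (1 + L ^+ 2) * q ^+ 2 by lra.
by rewrite invr_gt0 den0 invf_le1.
Qed.

Lemma peak_radius_gt0 r s L q : 0 < r -> 0 < s -> 1 <= q -> 0 < peak_radius r s L q.
Proof.
move=> r0 s0 /(hoelder_radius_itv L) /andP[th0 _].
have S0 : 0 < 1 + r + s by rewrite !addr_gt0.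
by apply: divr_gt0; apply: mulr_gt0 => //; exact: exprn_gt0.
Qed.

Lemma peak_radius_le r s L q : 0 < r -> 0 < s -> 1 <= q ->
  peak_radius r s L q <= hoelder_radius L q / 2.
Proof.
move=> r0 s0 /(hoelder_radius_itv L) /andP[th0 _].
have S0 : 0 < 1 + r + s by rewrite !addr_gt0.
have -> : peak_radius r s L q =
    hoelder_radius L q / 2 * (r ^+ 2 / (1 + r + s) ^+ 2).
  by rewrite /peak_radius; field; rewrite gt_eqF.
rewrite ger_pMr ?divr_gt0// ler_pdivrMr ?exprn_gt0// mul1r.
by rewrite ler_sqr ?nnegrE ?(ltW r0) ?(ltW S0)//; clear -r0 s0; lra.
Qed.

Lemma peak_dropE r s L q : 0 < r -> 0 < s ->
  2 * peak_drop r s L q = hoelder_radius L q * r / (2 * (1 + r + s) ^+ 2).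
Proof.
move=> r0 s0; have S0 : 0 < 1 + r + s by rewrite !addr_gt0.
by rewrite /peak_drop /peak_radius; field; rewrite !gt_eqF.
Qed.

Lemma peak_drop_itv r s L q : 0 < r -> 0 < s -> 1 <= q -> 0 < peak_drop r s L q <= 4^-1.
Proof.
move=> r0 s0 q1; have /andP[th0 th1] := hoelder_radius_itv L q1.
apply/andP; split.
  by apply: divr_gt0; [exact: peak_radius_gt0|exact: mulr_gt0].
have S0 : 0 < 1 + r + s by rewrite !addr_gt0.
have E := peak_dropE L q r0 s0.
suff : hoelder_radius L q * r / (2 * (1 + r + s) ^+ 2) <= 2^-1.
  by rewrite -E => h; clear -h; lra.
rewrite ler_pdivrMr ?mulr_gt0 ?exprn_gt0// mulKf//.
rewrite (le_trans (ler_piMl (ltW r0) th1))//.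
clear -r0 s0; nra.
Qed.

Lemma node_spread_bounds r s L q : 0 < r -> 0 < s -> 1 <= q ->
  [/\ 0 < node_spread r s L q, node_spread r s L q <= s &
      node_spread r s L q <= peak_drop r s L q ^+ 2 * r / 3].
Proof.
move=> r0 s0 q1; have /andP[nu0 nu4] := peak_drop_itv L r0 s0 q1.
have /andP[th0 th1] := hoelder_radius_itv L q1.
have nur : peak_drop r s L q * r <= 4^-1.
  have := peak_radius_le L r0 s0 q1.
  have -> : peak_drop r s L q * r = peak_radius r s L q / 2.
    by rewrite /peak_drop; field; rewrite gt_eqF.
  by move=> h; clear -h th1; lra.
have s10 : 0 < 1 + s by rewrite addr_gt0.
have nu2r : 0 < peak_drop r s L q ^+ 2 * r / 3.
  by rewrite divr_gt0// mulr_gt0// exprn_gt0.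
have ss : 0 < s / (1 + s) by exact: divr_gt0.
split; first exact: mulr_gt0.
- have -> : node_spread r s L q =
      s * (peak_drop r s L q * (peak_drop r s L q * r) / (3 * (1 + s))).
    by rewrite /node_spread; field; rewrite gt_eqF.
  rewrite ger_pMr// ler_pdivrMr ?mulr_gt0// mul1r.
  by clear -nur nu0 nu4 s0; nra.
- by rewrite /node_spread ger_pMl// ler_pdivrMr// mul1r lerDr.
Qed.

Lemma hoelder_radius_spec L q l m eta : 1 <= q -> 0 < l -> l <= L -> 0 <= m -> 0 <= eta ->
  eta <= q * (2 * Num.sqrt l * m) ->
  Num.sqrt (hoelder_radius L q * l) * eta <= m / 2 /\
  m + Num.sqrt l * eta <= sup_ratio L q * m.
Proof.
move=> q1 l0 lL m0 eta0 hm; have /andP[th0 _] := hoelder_radius_itv L q1.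
have q0 : 0 < q by exact: lt_le_trans q1.
have L0 : 0 < L by exact: lt_le_trans lL.
split.
  apply: (le_trans (ler_wpM2l (sqrtr_ge0 _) hm)).
  rewrite sqrtrM ?(ltW th0)//.
  have -> : Num.sqrt (hoelder_radius L q) * Num.sqrt l * (q * (2 * Num.sqrt l * m)) =
     (2 * q * Num.sqrt (hoelder_radius L q) * (Num.sqrt l ^+ 2)) * m by ring.
  rewrite (sqr_sqrtr (ltW l0)) [leRHS]mulrC ler_wpM2r//.
  rewrite -ler_sqr ?nnegrE ?mulr_ge0 ?sqrtr_ge0 ?(ltW q0) ?(ltW l0)//.
  rewrite !exprMn (sqr_sqrtr (ltW th0)) /hoelder_radius.
  have L2 : 0 < 1 + L ^+ 2 by rewrite ltr_wpDr// sqr_ge0.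
  have -> : 2 ^+ 2 * q ^+ 2 * (16 * (1 + L ^+ 2) * q ^+ 2)^-1 * l ^+ 2 =
     l ^+ 2 / (4 * (1 + L ^+ 2)) by field; rewrite !gt_eqF.
  rewrite ler_pdivrMr ?mulr_gt0//.
  have : l ^+ 2 <= L ^+ 2 by rewrite ler_sqr ?nnegrE ?(ltW l0) ?(ltW L0).
  by rewrite exprVn => h; clear -h; lra.
rewrite /sup_ratio mulrDl mul1r lerD2l (le_trans (ler_wpM2l (sqrtr_ge0 _) hm))//.
have -> : Num.sqrt l * (q * (2 * Num.sqrt l * m)) = Num.sqrt l ^+ 2 * (2 * q * m) by ring.
rewrite (sqr_sqrtr (ltW l0)) (_ : 2 * L * q * m = L * (2 * q * m)); last by ring.
by rewrite ler_wpM2r// mulr_ge0// mulr_ge0// ltW.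
Qed.

End Scales.

(** * The estimate with explicit constants *)

Section Observability.
Context {R : realType}.
Local Notation mu := (@lebesgue_measure R).

Definition observability_const (r s L q : R) (N : nat) : R :=
  2 ^+ N * (8 * (1 + r + s) / peak_radius r s L q) *
  (3 / 2 + r * inv_cell r s L q N) ^+ N.*2 * Num.sqrt (inv_cell r s L q N).

(** The hypothesis on N says that the contrast of the peak compensates both the
    smallness of its width and the size of g away from t0: the negative
    contribution in [peak_integral_ge] is then at most half of the positive one. *)
Lemma observability (a b c d r s sg L q : R) (N : nat) (g h : R -> R) :
  0 < r -> 0 < s -> 1 <= q -> c < d -> d - c <= L -> b - a = s * (d - c) ->
  `|sg| = 1 ->
  (forall x t, x \in `]a, b[ -> t \in `]c, d[ ->
    r * (d - c) <= sg * (t - x) <= (1 + r + s) * (d - c)) ->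
  L2 `]c, d[ g -> L2 `]c, d[ h -> is_weak_derivative `]c, d[ g h ->
  0 < L2norm `]c, d[ g -> L2norm `]c, d[ h <= q * L2norm `]c, d[ g ->
  (1 - 2 * peak_drop r s L q ^+ 2) ^+ N * (sup_ratio L q / r) <=
    peak_radius r s L q / (4 * (1 + r + s)) ->
  L2norm `]c, d[ g <=
    observability_const r s L q N * L2norm `]a, b[ (truncated_hilbert `]c, d[ g).
Proof.
move=> r0 s0 q1 cd lL bas sg1 sep gL2 hL2 gh g0 hg HN.
have [l lE] : exists l, l = d - c by exists (d - c).
have [S SE] : exists S, S = 1 + r + s by exists (1 + r + s).
rewrite -lE in lL bas sep; rewrite -SE in sep HN.
have l0 : 0 < l by rewrite lE subr_gt0.
have S0 : 0 < S by rewrite SE !addr_gt0.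
have /andP[th0 th1] := hoelder_radius_itv L q1.
have w0 := peak_radius_gt0 L r0 s0 q1.
have wth := peak_radius_le L r0 s0 q1.
have /andP[nu0 nu4] := peak_drop_itv L r0 s0 q1.
have [rho0 rho_s rho_nu] := node_spread_bounds L r0 s0 q1.
have nu2E := peak_dropE L q r0 s0; rewrite -SE in nu2E.
have nuE : peak_drop r s L q = peak_radius r s L q / (2 * r) by [].
have TE : inv_cell r s L q N = N.*2.*2.+1%:R / node_spread r s L q by [].
rewrite /observability_const -SE.
set th := hoelder_radius L q in th0 th1 wth nu2E.
set w := peak_radius r s L q in HN w0 wth nuE *.
set nu := peak_drop r s L q in HN nu0 nu4 rho_nu nu2E nuE.
set rho := node_spread r s L q in rho0 rho_s rho_nu TE.
set T := inv_cell r s L q N in TE *.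
set B := sup_ratio L q in HN.
have n0 : 0 < N.*2.*2.+1%:R :> R by rewrite ltr0n.
have T0 : 0 < T by rewrite TE divr_gt0.
pose lam := rho * l / N.*2.*2.+1%:R.
have lamE : N.*2.*2.+1%:R * lam = rho * l by rewrite /lam mulrC divfK// gt_eqF.
have lam0 : 0 < lam by rewrite divr_gt0// mulr_gt0.
have lT : l = T * lam by rewrite TE /lam; field; rewrite !gt_eqF.
have rl0 : 0 < r * l by exact: mulr_gt0.
have base0 : 0 < 3 / 2 + r * T by rewrite addr_gt0 ?divr_gt0// mulr_gt0.
have w8 : 0 < 8 * S / w by rewrite divr_gt0// mulr_gt0.
have K0 : 0 < 2 ^+ N * (8 * S / w) * (3 / 2 + r * T) ^+ N.*2 * Num.sqrt T.
  apply: mulr_gt0; last by rewrite sqrtr_gt0.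
  apply: mulr_gt0; last exact: exprn_gt0.
  by apply: mulr_gt0 => //; exact: exprn_gt0.
have mJ : measurable [set` `]c, d[] by exact: measurable_itv.
have gi := L2_integrable mJ mJ (@subset_refl _ _) (lebesgue_measure_oo_lty c d) gL2.
have sepn x t : x \in `]a, b[ -> t \in `]c, d[ -> r * l <= `|t - x|.
  move=> xI tJ; have /andP[h1 _] := sep x t xI tJ.
  by rewrite -[`|t - x|]mul1r -sg1 -normrM (le_trans h1)// ler_norm.
have HL2 : L2 `]a, b[ (truncated_hilbert `]c, d[ g).
  by apply: (@truncated_hilbert_L2 _ _ _ _ _ (r * l)).
(* Strictly above the norm, so that small values exist in every cell even if
   the norm vanishes. *)
apply: le_mul_of_gt => // eps Heps.
have eps0 : 0 < eps by apply: le_lt_trans Heps; exact: L2norm_ge0.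
have aub : a + N.*2.*2.+1%:R * lam <= b.
  have : rho * l <= s * l by rewrite ler_pM2r.
  by rewrite lamE -lerBrDl bas.
have [X [XI X0 Xsep Xval]] := exists_nodes HL2 lam0 aub Heps.
have [E [mE muE Egood]] := ae_lebesgue_pt gL2.
have [t0 [t0J Et0 gt0]] := exists_large_value cd gL2 mE muE g0.
rewrite -lE in gt0; set m := `|g t0| in gt0.
have m0 : 0 <= m by exact: normr_ge0.
have h0 : 0 <= L2norm `]c, d[ h by exact: L2norm_ge0.
have hm : L2norm `]c, d[ h <= q * (2 * Num.sqrt l * m).
  by rewrite (le_trans hg)// ler_wpM2l// (le_trans ler01).
have [osc sup] := hoelder_radius_spec q1 l0 lL m0 h0 hm.
rewrite -/th in osc; rewrite -/B in sup.
have lebE t : ~ E t -> lebesgue_pt (g \_ `]c, d[) t.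
  by move=> Et; apply: contrapT => nl; apply: Et; exact: Egood.
have holder t : t \in `]c, d[ -> ~ E t ->
    `|g t - g t0| <= Num.sqrt `|t - t0| * L2norm `]c, d[ h.
  by move=> tJ Et; apply: weak_derivative_holder => //; exact: lebE.
have gnear t : t \in `]c, d[ -> ~ E t -> `|t - t0| <= th * l -> `|g t - g t0| <= m / 2.
  move=> tJ Et tt0; apply: (le_trans (holder t tJ Et)); apply: le_trans osc.
  by rewrite ler_wpM2r// ler_wsqrtr.
have gB t : t \in `]c, d[ -> ~ E t -> `|g t| <= B * m.
  move=> tJ Et; have -> : g t = g t0 + (g t - g t0) by rewrite addrC subrK.
  apply: (le_trans (ler_normD _ _)); apply: le_trans sup; rewrite lerD2l.
  apply: (le_trans (holder t tJ Et)); rewrite ler_wpM2r// ler_wsqrtr//.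
  move: tJ t0J; rewrite !in_itv/= lE ler_norml => /andP[k1 k2] /andP[k3 k4].
  by clear -k1 k2 k3 k4; apply/andP; split; lra.
pose PK := peaked_kernel (r * l) t0 (X 0%N) X N.
have PKb t : t \in `]c, d[ ->
    [/\ 0 <= sg * PK t,
        `|t - t0| <= w * l -> (1 - 3 / 2 * nu ^+ 2) ^+ N / (S * l) <= sg * PK t &
        th * l <= `|t - t0| ->
          sg * PK t <= ((1 - 2 * nu ^+ 2) * (1 - 3 / 2 * nu ^+ 2)) ^+ N / (r * l)].
  move=> tJ; apply: (peaked_kernel_bounds sg1 rl0 _ (sep _ _ (XI 0%N isT) tJ)
      (sep _ _ (XI 0%N isT) t0J)).
  - by rewrite (ltW nu0) (le_trans nu4)// lef_pV2 ?posrE// ler_nat.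
  - by move=> i iN; exact: sep (XI i iN) tJ.
  - move=> i iN; rewrite (le_trans (X0 i iN))// lamE.
    have -> : nu ^+ 2 * (r * l) / 3 = nu ^+ 2 * r / 3 * l by ring.
    by rewrite ler_pM2r.
  - by rewrite nuE le_eqVlt; apply/orP; left; apply/eqP; field; rewrite !gt_eqF.
  - by rewrite nu2E le_eqVlt; apply/orP; left; apply/eqP; field; rewrite !gt_eqF.
have bPK : bounded_mfun `]c, d[ PK.
  apply: bounded_mfun_peaked_kernel => // i t iN tJ.
  exact: sepn (XI i iN) tJ.
have upper : `|\int[mu]_(t in `]c, d[) (g t * PK t)| <=
    (3 / 2 + r * T) ^+ N.*2 * (eps / Num.sqrt lam).
  have -> : r * T = r * l / lam by rewrite lT; field; rewrite gt_eqF.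
  apply: peaked_kernel_pairing => //.
  - by rewrite divr_ge0 ?sqrtr_ge0 ?(ltW eps0).
  - by move=> i t iN tJ; exact: sepn (XI i iN) tJ.
have nu2_lt : nu ^+ 2 <= 4^-1 by clear -nu0 nu4; nra.
pose P := 1 - 3 / 2 * nu ^+ 2.
have P2 : 2^-1 <= P by rewrite /P; clear -nu2_lt; lra.
have P0 : 0 <= P by rewrite (le_trans _ P2)// invr_ge0.
have Q0 : 0 <= (1 - 2 * nu ^+ 2) * P.
  by rewrite mulr_ge0//; clear -nu2_lt; lra.
have lower : m * (2^-1 ^+ N * (w / (4 * S))) <= `|\int[mu]_(t in `]c, d[) (g t * PK t)|.
  have bsPK : bounded_mfun `]c, d[ (fun t => sg * PK t).
    by apply: bounded_mfunM => //; exact: bounded_mfun_cst.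
  have B0 : 0 <= B.
    have q0 : 0 <= q by exact: le_trans q1.
    have L0 : 0 <= L by exact: le_trans (ltW l0) lL.
    by rewrite /B /sup_ratio addr_ge0// mulr_ge0// mulr_ge0.
  have wl : w * l <= (d - c) / 2.
    by rewrite -lE mulrC ler_wpM2l ?(ltW l0)// (le_trans wth)//; clear -th1; lra.
  have wthl : w * l <= th * l by rewrite ler_pM2r//; clear -wth th0; lra.
  have lo0 : 0 <= P ^+ N / (S * l).
    by rewrite divr_ge0 ?exprn_ge0// mulr_ge0// ltW.
  have hi0 : 0 <= ((1 - 2 * nu ^+ 2) * P) ^+ N / (r * l).
    by rewrite divr_ge0 ?exprn_ge0// ltW.
  have := peak_integral_ge t0J (mulr_gt0 w0 l0) wl wthl lo0 hi0 B0 mE muE bsPK gi PKb gnear gB.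
  have -> : \int[mu]_(t in `]c, d[) (g t * (sg * PK t)) =
      sg * \int[mu]_(t in `]c, d[) (g t * PK t).
    rewrite -RintegralZl//; last exact: (integrable_bounded_mfun mJ bPK gi).
    by apply: eq_Rintegral => t _; rewrite mulrCA.
  rewrite normrM sg1 mul1r; apply: le_trans; rewrite -/m -lE; apply: ler_wpM2l => //.
  have -> : P ^+ N / (S * l) / 2 * (w * l) -
      B * (((1 - 2 * nu ^+ 2) * P) ^+ N / (r * l)) * l =
      P ^+ N * (w / (2 * S) - (1 - 2 * nu ^+ 2) ^+ N * (B / r)).
    by rewrite exprMn; field; rewrite !gt_eqF.
  have wS : w / (4 * S) <= w / (2 * S) - (1 - 2 * nu ^+ 2) ^+ N * (B / r).
    have -> : w / (2 * S) = w / (4 * S) + w / (4 * S) by field; rewrite gt_eqF.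
    by rewrite -addrA lerDl subr_ge0.
  have wS0 : 0 <= w / (4 * S).
    by apply: divr_ge0; [exact: ltW|apply: mulr_ge0 => //; exact: ltW].
  apply: ler_pM => //.
  by apply: lerXn2r; rewrite ?nnegrE// invr_ge0.
have slT : Num.sqrt l = Num.sqrt T * Num.sqrt lam by rewrite {1}lT sqrtrM// ltW.
have slam : 0 < Num.sqrt lam by rewrite sqrtr_gt0.
apply: (le_trans gt0).
(* The width of a cell is l / T, whence the factor sqrt T. *)
have -> : 2 * Num.sqrt l * m =
    Num.sqrt l * (2 ^+ N * (8 * S / w)) * (m * (2^-1 ^+ N * (w / (4 * S)))).
  by rewrite exprVn; field; rewrite !gt_eqF// exprn_gt0.
have Kp : 0 <= Num.sqrt l * (2 ^+ N * (8 * S / w)).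
  by rewrite mulr_ge0 ?sqrtr_ge0// mulr_ge0 ?exprn_ge0// ltW.
apply: (le_trans (ler_wpM2l Kp (le_trans lower upper))).
rewrite le_eqVlt; apply/orP; left; apply/eqP; rewrite slT; field.
by rewrite !gt_eqF.
Qed.

End Observability.

(** * The cost is exponential in a power of q *)

Section Cost.
Context {R : realType}.

(** An elementary decay rate for (1 - x)^N, sufficient since only the polynomial
    growth of N in q matters. *)
Lemma reverse_bernoulli (x : R) (N : nat) : 0 <= x <= 1 ->
  (1 + N%:R * x) * (1 - x) ^+ N <= 1.
Proof.
move=> /andP[x0 x1]; elim: N => [|N IH]; first by rewrite mul0r addr0 expr0 mulr1.
apply: le_trans IH; rewrite exprS mulrA ler_wpM2r ?exprn_ge0 ?subr_ge0//.
rewrite -natr1; have : 0 <= N%:R * x ^+ 2 by rewrite mulr_ge0// sqr_ge0.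
have := sqr_ge0 x; lra.
Qed.

Lemma le_expR (x : R) : x <= expR x.
Proof. by have := expR_ge1Dx x; lra. Qed.

(** The radii are constants times q^-2, the spread of the nodes is a constant
    times q^-4, so N of order q^7 suffices and the inverse cell length is of
    order q^11.  Each factor x of the constant is bounded by e^x, and the largest
    exponent, N times the inverse cell length, is of order q^18. *)
Lemma observability_cost (r s L : R) : 0 < r -> 0 < s -> 0 < L ->
  exists2 C : R, 1 < C & forall q : R, 1 <= q -> exists N : nat,
  (1 - 2 * peak_drop r s L q ^+ 2) ^+ N * (sup_ratio L q / r) <=
    peak_radius r s L q / (4 * (1 + r + s)) /\
  q * observability_const r s L q N <= expR (C * q ^+ 18).
Proof.
move=> r0 s0 L0.
pose S := 1 + r + s.
have SE : S = 1 + r + s by [].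
clearbody S.
have S0 : 0 < S by lra.
have L20 : 0 <= L ^+ 2 by exact: sqr_ge0.
pose k1 := (16 * (1 + L ^+ 2))^-1 * r ^+ 2 / (2 * S ^+ 2).
have k10 : 0 < k1.
  rewrite /k1 divr_gt0// ?mulr_gt0 ?exprn_gt0// invr_gt0; lra.
pose k2 := k1 / (2 * r).
have k20 : 0 < k2 by rewrite divr_gt0// mulr_gt0.
have k21 : 2 * k2 ^+ 2 <= 1.
  have h1 : (16 * (1 + L ^+ 2))^-1 <= 1 by rewrite invf_le1; lra.
  have h2 : 0 < (16 * (1 + L ^+ 2))^-1 by rewrite invr_gt0; lra.
  have : k2 <= 4^-1.
    have -> : k2 = (16 * (1 + L ^+ 2))^-1 * (r / S ^+ 2) / 4.
      by rewrite /k2 /k1; field; rewrite !gt_eqF//; lra.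
    have : r / S ^+ 2 <= 1.
      by rewrite ler_pdivrMr ?exprn_gt0// mul1r; nra.
    have : 0 <= r / S ^+ 2 by rewrite divr_ge0 ?sqr_ge0// ltW.
    nra.
  nra.
pose k3 := s / (1 + s) * (k2 ^+ 2 * r / 3).
have s10 : 0 < 1 + s by lra.
have k220 : 0 < k2 ^+ 2 by exact: exprn_gt0.
have k30 : 0 < k3 by apply: mulr_gt0; apply: divr_gt0 => //; exact: mulr_gt0.
pose k4 := 2 * S * (1 + 2 * L) / (r * k1 * k2 ^+ 2).
have k40 : 0 < k4.
  have L1 : 0 < 1 + 2 * L by lra.
  by apply: divr_gt0; apply: mulr_gt0 => //; exact: mulr_gt0.
pose n1 := k4 + 1.
pose k5 := (4 * n1 + 1) / k3.
have n10 : 0 < n1 by rewrite /n1; lra.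
have k50 : 0 < k5 by rewrite divr_gt0//; lra.
pose C := 1 + n1 + 8 * S / k1 + 2 * n1 * (3 / 2 + r * k5) + k5.
have rk5 : 0 < r * k5 by exact: mulr_gt0.
have Sk1 : 0 < 8 * S / k1 by rewrite divr_gt0// mulr_gt0.
exists C.
  have : 0 < 2 * n1 * (3 / 2 + r * k5) by rewrite !mulr_gt0//; lra.
  rewrite /C; lra.
move=> q q1.
have q0 : 0 < q by lra.
have qX (i : nat) : 1 <= q ^+ i by exact: exprn_ege1.
have qX0 (i : nat) : 0 < q ^+ i by exact: exprn_gt0.
have qXle (i j : nat) : (i <= j)%N -> q ^+ i <= q ^+ j by move=> ij; exact: ler_weXn2l.
pose N := (Num.truncn (k4 * q ^+ 7)).+1.
have /andP[Nlo Nhi] : (k4 * q ^+ 7 < N%:R) && (N%:R <= n1 * q ^+ 7).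
  have kq0 : 0 <= k4 * q ^+ 7 by rewrite mulr_ge0// ltW.
  have := truncn_itv kq0; rewrite -/N => /andP[h1 h2]; rewrite h2 /=.
  rewrite /N -natr1 /n1 mulrDl mul1r lerD//; exact: qX.
exists N; rewrite /observability_const -SE.
have th'E : peak_radius r s L q = k1 / q ^+ 2.
  have L2 : 0 < 1 + L ^+ 2 by rewrite ltr_wpDr.
  by rewrite /peak_radius /hoelder_radius -SE /k1; field; rewrite !gt_eqF.
have nuE : peak_drop r s L q = k2 / q ^+ 2.
  by rewrite /peak_drop th'E /k2; field; rewrite !gt_eqF.
have rhoE : node_spread r s L q = k3 / q ^+ 4.
  by rewrite /node_spread nuE /k3; field; rewrite !gt_eqF.
have TE : inv_cell r s L q N = N.*2.*2.+1%:R / node_spread r s L q by [].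
have BE : sup_ratio L q = 1 + 2 * L * q by [].
move: (peak_radius r s L q) (peak_drop r s L q) (node_spread r s L q) (inv_cell r s L q N)
  (sup_ratio L q) th'E nuE rhoE TE BE => th' nu rho T B th'E nuE rhoE TE BE.
clearbody N.
have Tle : T <= k5 * q ^+ 11.
  have -> : T = N.*2.*2.+1%:R * q ^+ 4 / k3.
    by rewrite TE rhoE; field; rewrite !gt_eqF.
  rewrite ler_pdivrMr//.
  have -> : k5 * q ^+ 11 * k3 = (4 * n1 + 1) * q ^+ 7 * q ^+ 4.
    by rewrite /k5; field; rewrite gt_eqF.
  rewrite ler_pM2r//.
  have -> : N.*2.*2.+1%:R = 4 * N%:R + 1 :> R.
    by rewrite -natr1 -!muln2 !natrM; ring.
  have := qX 7; nra.
have rho0 : 0 < rho by rewrite rhoE divr_gt0.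
have T0 : 0 < T by rewrite TE divr_gt0// ltr0n.
have rho1 : rho <= k3 by rewrite rhoE ler_pdivrMr// ler_peMr// ltW.
split.
  pose x := 2 * nu ^+ 2.
  have x0 : 0 < x by rewrite /x nuE mulr_gt0// exprn_gt0// divr_gt0.
  have x1 : x <= 1.
    rewrite /x nuE expr_div_n mulrA ler_pdivrMr ?exprn_gt0// mul1r.
    by rewrite (le_trans k21)// exprn_ege1.
  have xE : x = 2 * k2 ^+ 2 / q ^+ 4 by rewrite /x nuE; field; rewrite gt_eqF.
  (* N exceeds k4 q^7, where k4 was chosen so that 1 / (N x) meets the target. *)
  have Nx : 4 * S * (1 + 2 * L) * q ^+ 3 / (r * k1) <= N%:R * x.
    have -> : 4 * S * (1 + 2 * L) * q ^+ 3 / (r * k1) = k4 * q ^+ 7 * x.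
      by rewrite xE /k4; field; rewrite !gt_eqF.
    by rewrite ler_pM2r// ltW.
  have num0 : 0 < 4 * S * (1 + 2 * L) * q ^+ 3 / (r * k1).
    have L1 : 0 < 1 + 2 * L by lra.
    by apply: divr_gt0; apply: mulr_gt0 => //; apply: mulr_gt0 => //; exact: mulr_gt0.
  have Nx0 : 0 < N%:R * x.
    exact: lt_le_trans Nx.
  have pw : (1 - x) ^+ N <= (N%:R * x)^-1.
    have := @reverse_bernoulli x N; rewrite (ltW x0) x1 => /(_ isT) h.
    rewrite -[leRHS]mul1r ler_pdivlMr// mulrC (le_trans _ h)//.
    by rewrite ler_wpM2r ?exprn_ge0 ?subr_ge0// lerDr.
  have Bq : B <= (1 + 2 * L) * q by rewrite BE; lra.
  have B0 : 0 <= B by rewrite BE addr_ge0// !mulr_ge0// ltW.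
  apply: (@le_trans _ _ ((4 * S * (1 + 2 * L) * q ^+ 3 / (r * k1))^-1 * ((1 + 2 * L) * q / r))).
    apply: ler_pM.
    - by rewrite exprn_ge0// subr_ge0.
    - by rewrite divr_ge0// ltW.
    - apply: (le_trans pw); rewrite lef_pV2 ?posrE//.
    - by rewrite ler_pM2r ?invr_gt0.
  rewrite th'E le_eqVlt; apply/orP; left; apply/eqP; field.
  by rewrite !gt_eqF//; lra.
have T_ge0 := ltW T0.
have base0 : 0 <= 3 / 2 + r * T by rewrite addr_ge0// mulr_ge0// ltW.
have sqrtT : Num.sqrt T <= expR T.
  have : Num.sqrt T <= 1 + T.
    rewrite -ler_sqr ?nnegrE ?sqrtr_ge0 ?addr_ge0// sqr_sqrtr//.
    have := sqr_ge0 T; lra.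
  by move/le_trans; apply; exact: expR_ge1Dx.
have base : (3 / 2 + r * T) ^+ N.*2 <= expR (N.*2%:R * (3 / 2 + r * T)).
  by rewrite expRM_natl lerXn2r ?nnegrE ?expR_ge0// le_expR.
have pow2 : 2 ^+ N <= expR (N%:R * 1) :> R.
  by rewrite expRM_natl lerXn2r ?nnegrE ?expR_ge0//; have := expR_ge1Dx (1 : R); lra.
have St : 8 * S / th' <= expR (8 * S / th') by exact: le_expR.
have th'0 : 0 < th' by rewrite th'E divr_gt0.
have St0 : 0 <= 8 * S / th' by rewrite divr_ge0// ?ltW// mulr_gt0.
apply: (@le_trans _ _ (expR (q + (N%:R * 1 + 8 * S / th' + N.*2%:R * (3 / 2 + r * T) + T)))).
  have p1 : 0 <= 2 ^+ N :> R by exact: exprn_ge0.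
  have p2 := mulr_ge0 p1 St0.
  have p3 := mulr_ge0 p2 (exprn_ge0 N.*2 base0).
  have p4 := mulr_ge0 p3 (sqrtr_ge0 T).
  rewrite !expRD; apply: ler_pM => //; [exact: ltW|exact: le_expR|].
  apply: ler_pM => //.
  apply: ler_pM => //; first exact: exprn_ge0.
  exact: ler_pM.
rewrite ler_expR mulr1.
have e1 : q <= q ^+ 18 by rewrite -[leLHS]expr1 qXle.
have e2 : N%:R <= n1 * q ^+ 18.
  by rewrite (le_trans Nhi)// ler_pM2l// qXle.
have e3 : 8 * S / th' <= 8 * S / k1 * q ^+ 18.
  have -> : 8 * S / th' = 8 * S / k1 * q ^+ 2 by rewrite th'E; field; rewrite !gt_eqF.
  by rewrite ler_pM2l// qXle.
have e5 : T <= k5 * q ^+ 18.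
  by rewrite (le_trans Tle)// ler_pM2l// qXle.
have e4 : N.*2%:R * (3 / 2 + r * T) <= 2 * n1 * (3 / 2 + r * k5) * q ^+ 18.
  have -> : 2 * n1 * (3 / 2 + r * k5) * q ^+ 18 =
     (2 * (n1 * q ^+ 7)) * ((3 / 2 + r * k5) * q ^+ 11) by ring.
  apply: ler_pM => //.
    by rewrite -muln2 natrM mulrC ler_pM2l.
  have : r * T <= r * (k5 * q ^+ 11) by rewrite ler_pM2l.
  have := qX 11; lra.
have -> : C * q ^+ 18 = q ^+ 18 + n1 * q ^+ 18 + 8 * S / k1 * q ^+ 18
    + 2 * n1 * (3 / 2 + r * k5) * q ^+ 18 + k5 * q ^+ 18 by rewrite /C; ring.
lra.
Qed.

End Cost.

(* The quantifier over L records the unit of length: with the usual H^1 norm the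
   estimate is not invariant under dilations, and it fails for any C independent
   of an upper bound on |J|. For L = 1, which covers the normalization
   J = ]0, 1[, both constants depend on s and r only. *)
Theorem proposition1p1 (R : realType) (s r : R)
    (s_gt0 : 0 < s) (r_gt0 : 0 < r) :
  exists2 sigma : R, 0 < sigma &
  forall L : R, 0 < L ->
  exists2 C : R, 1 < C &
  forall a b c d : R, a < b -> c < d ->
    closure `]a, b[ `&` closure `]c, d[ = set0 ->
    relative_size a b c d = s ->
    relative_distance a b c d = r ->
    d - c <= L ->
  forall g : R -> R, H1 `]c, d[ g ->
    ~ {ae @lebesgue_measure R, forall x, x \in `]c, d[ -> g x = 0} ->
    H1norm `]c, d[ g <=
      expR (C * (1 + H1norm `]c, d[ g `^ sigma / L2norm `]c, d[ g `^ sigma)) *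
      L2norm `]a, b[ (truncated_hilbert `]c, d[ g).
Proof.
(* The power of q in [observability_cost]. *)
exists 18%:R => // L L0.
have [C C1 HC] := observability_cost r_gt0 s_gt0 L0.
exists C => // a b c d ab cd _ sizeE distE dL g [gL2 gH1] gn0.
have [bas [sg sg1 sep]] := separated_intervals ab cd r_gt0 sizeE distE.
have mJ : measurable [set` `]c, d[] by exact: measurable_itv.
set h := weak_derivative `]c, d[ g.
have [hL2 gh] : L2 `]c, d[ h /\ is_weak_derivative `]c, d[ g h.
  have [h0 h0P] := gH1.
  exact: (@xgetPex _ (cst 0) [set h | L2 `]c, d[ h /\ is_weak_derivative `]c, d[ g h]
    (ex_intro _ h0 h0P)).
set ga := L2norm `]c, d[ g; set q := H1norm `]c, d[ g / ga.
have ga0 : 0 < ga.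
  rewrite lt_neqAle L2norm_ge0 andbT eq_sym; apply/eqP => ga0.
  exact: gn0 (L2norm_eq0_ae mJ gL2 ga0).
have eta0 : 0 <= L2norm `]c, d[ h by exact: L2norm_ge0.
have H1q : H1norm `]c, d[ g = q * ga by rewrite /q divfK// gt_eqF.
have q1 : 1 <= q.
  rewrite /q ler_pdivlMr// mul1r /H1norm -/ga -/h -{1}(ger0_norm (ltW ga0)) -sqrtr_sqr.
  by rewrite ler_wsqrtr// lerDl sqr_ge0.
have etaq : L2norm `]c, d[ h <= q * ga.
  rewrite -H1q /H1norm -/h -{1}(ger0_norm eta0) -sqrtr_sqr.
  by rewrite ler_wsqrtr// lerDr sqr_ge0.
have [N [HN cost]] := HC q q1.
have obs := observability r_gt0 s_gt0 q1 cd dL bas sg1 sep gL2 hL2 gh ga0 etaq HN.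
have -> : H1norm `]c, d[ g `^ 18%:R / ga `^ 18%:R = q ^+ 18.
  rewrite H1q powRM ?(ltW ga0)//; last by rewrite (le_trans ler01).
  rewrite mulfK; last by rewrite gt_eqF// powR_gt0.
  by rewrite powR_mulrn// (le_trans ler01).
have q0 : 0 < q by exact: lt_le_trans q1.
rewrite H1q.
apply: (le_trans (ler_wpM2l (ltW q0) obs)).
rewrite mulrA ler_wpM2r ?L2norm_ge0//.
apply: (le_trans cost); rewrite ler_expR ler_wpM2l// ?lerDr//.
exact: le_trans (ltW C1).
Qed.
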